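(* Let $(\alpha_k)_{k\in\mathbb N}$ be a real sequence with $\alpha_1\geq\alpha_2\geq\ldots\geq0$ and $\lim_k\alpha_k=0$. Let $X$ be a Banach space with no non-trivial cotype and $Y$ a Banach space with no non-trivial type. Then there exists $T\in B(X,Y)$ such that $$\frac1{50}\,\alpha_{18m}\leq c_m(T)\leq c_m^{(\mathcal A)}(T)\leq a_m^{(\mathcal A)}(T)\leq 4\,\alpha_{\lceil 4m/5\rceil}$$ for every $m\in\mathbb N$ and every $1$-injective Banach operator ideal $\mathcal A$.
   Context: $X$ has no non-trivial cotype if it does not have cotype $q$ for any $q<\infty$; $Y$ has no non-trivial type if it does not have type $p$ for any $p>1$. A Banach operator ideal $\mathcal A$ is equipped with its (complete) ideal norm $\|\cdot\|_{\mathcal A}$, with the usual axioms (in particular $\|vTu\|_{\mathcal A}\le\|v\|\,\|T\|_{\mathcal A}\|u\|$, and rank one operators have ideal norm equal to their operator norm); $\|T\|_{\mathcal A}=\infty$ if $T\notin\mathcal A$. The ideal is $1$-injective if for any $u\in B(X,Y)$ and any isometric injection $J:Y\to Y_0$ one has $\|u\|_{\mathcal A}=\|Ju\|_{\mathcal A}$. For $T\in B(X,Y)$ and $n\geq1$ the Gelfand numbers are $c_n(T)=\inf\{\|T|_E\|:E\subset X\text{ closed subspace},\ \mathrm{codim}\,E<n\}$, and $$a_n^{(\mathcal A)}(T)=\inf_{u\in B(X,Y),\ \mathrm{rank}\,u<n}\|T-u\|_{\mathcal A},\qquad c_n^{(\mathcal A)}(T)=\inf_{E\subset X\text{ closed subspace},\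 \mathrm{codim}\,E<n}\|T|_E\|_{\mathcal A}.$$ *)

(* Defs.v *)
From HB Require Import structures.
From mathcomp Require Import all_boot all_order all_algebra.
From mathcomp Require Import complex.
From mathcomp Require Import all_classical all_reals all_analysis.

Set Implicit Arguments.
Unset Strict Implicit.
Unset Printing Implicit Defensive.

Import Order.TTheory GRing.Theory Num.Theory.
Import numFieldNormedType.Exports.

Local Open Scope classical_set_scope.
Local Open Scope ring_scope.

Variant scalars := RealScalars | ComplexScalars.

Definition scalar_field (R : realType) (s : scalars) : numFieldType :=
  match s with
  | RealScalars => R : numFieldType
  | ComplexScalars => R[i] : numFieldType
  end.

(* The library norm of a complex normed module is a nonnegative element of
   [R[i]]; [rnorm] is the same number seen in [R]. *)
Definition scalar_re (R : realType) (s : scalars) : scalar_field R s -> R :=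
  match s return scalar_field R s -> R with
  | RealScalars => fun z => z
  | ComplexScalars => fun z => complex.Re z
  end.

Definition rnorm (R : realType) (s : scalars)
  (X : normedModType (scalar_field R s)) (x : X) : R := scalar_re `|x|.

Notation banachType R s := (completeNormedModType (scalar_field R s)).

Section ClosedSubspace.
Variables (K : numFieldType) (X : completeNormedModType K).

Record closed_subspace := ClosedSubspace {
  cs_set :> set X;
  cs_submod : submod_closed [pred x | x \in cs_set];
  cs_closed : closed cs_set
}.

Variable E : closed_subspace.

Definition cs_pred : {pred X} := [pred x | x \in cs_set E].

HB.instance Definition _ := GRing.isSubmodClosed.Build K X cs_pred (cs_submod E).

Definition subspace_of : Type := {x : X | x \in cs_pred}.

Definition incl : subspace_of -> X := val.

HB.instance Definition _ := [isSub of subspace_of for incl].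
HB.instance Definition _ := [Choice of subspace_of by <:].
HB.instance Definition _ := [SubChoice_isSubLmodule of subspace_of by <:].

End ClosedSubspace.

Arguments incl {K X E} x : rename.

Section ClosedSubspaceNorm.
Variables (K : numFieldType) (X : completeNormedModType K).
Variable E : closed_subspace X.

Implicit Types x y : subspace_of E.

Let nrm x : K := `|incl x|.

Let nrmD x y : nrm (x + y) <= nrm x + nrm y.
Proof. exact: ler_normD. Qed.

Let nrmZ (a : K) x : nrm (a *: x) = `|a| * nrm x.
Proof. exact: normrZ. Qed.

Let nrm0 x : nrm x = 0 -> x = 0.
Proof. by move=> /normr0_eq0 x0; apply: val_inj. Qed.

HB.instance Definition _ :=
  Lmodule_isNormed.Build K (subspace_of E) nrmD nrmZ nrm0.

Lemma norm_incl x : `|incl x| = `|x|.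
Proof. by []. Qed.

Lemma subspace_of_complete (F : set_system (subspace_of E)) :
  ProperFilter F -> cauchy F -> cvg F.
Proof.
move=> FF /cauchy_ballP Fc; apply/cvg_ex.
have /cvg_ex[l Fl] : cvg ((incl : subspace_of E -> X) @ F).
  have FE : ProperFilter ((incl : subspace_of E -> X) @ F).
    exact: fmap_proper_filter.
  apply: cauchy_cvg; apply/cauchy_ballP => e e0.
  have [[A B]/= [FA FB] AB] := Fc e e0.
  exists (incl @` A, incl @` B) => /=.
    by split; [apply: filterS FA|apply: filterS FB] => z Az; exists z.
  move=> [_ _] [[a Aa <-] [b Bb <-]] /=.
  by have := AB (a, b) (conj Aa Bb); rewrite -!ball_normE.
have El : cs_set E l.
  apply: (closed_cvg _ (@cs_closed _ _ E) _ _ Fl).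
  by apply: nearW => x; exact: set_mem (valP x).
exists (exist _ l (mem_set El) : subspace_of E).
apply/cvgrPdist_lt => e e0; move/cvgrPdist_lt: Fl => /(_ e e0).
exact.
Qed.

HB.instance Definition _ :=
  Uniform_isComplete.Build (subspace_of E) subspace_of_complete.

End ClosedSubspaceNorm.

Section Operators.
Variables (R : realType) (s : scalars).
Local Notation K := (scalar_field R s).

Definition bounded_op (X Y : banachType R s) (T : X -> Y) : Prop :=
  linear T /\ continuous T.

Definition opnorm (X Y : banachType R s) (T : X -> Y) : \bar R :=
  ereal_sup [set (rnorm (T x))%:E | x in [set x : X | rnorm x <= 1]].

Definition rank_lt (n : nat) (X Y : banachType R s) (u : X -> Y) : Prop :=
  exists2 k : nat, (k < n)%N & exists y : 'I_k -> Y,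
    forall x, exists c : 'I_k -> K, u x = \sum_(i < k) c i *: y i.

(* [codim_lt n E] says that the dimension of [X / E] is less than [n]. *)
Definition codim_lt (n : nat) (X : banachType R s) (E : set X) : Prop :=
  exists2 k : nat, (k < n)%N & exists y : 'I_k -> X,
    forall x, exists c : 'I_k -> K, E (x - \sum_(i < k) c i *: y i).

Definition isometric_injection (X Y : banachType R s) (J : X -> Y) : Prop :=
  linear J /\ forall x, `|J x| = `|x|.

(* [inorm X Y T] is [+oo] when [T] is not in the ideal; in particular when the
   function [T] is not a bounded operator. *)
Record banach_ideal := BanachIdeal {
  inorm : forall X Y : banachType R s, (X -> Y) -> \bar R;
  inorm_ge0 : forall (X Y : banachType R s) (T : X -> Y), (0 <= inorm T)%E;
  inorm_bounded_op : forall (X Y : banachType R s) (T : X -> Y),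
    (inorm T < +oo)%E -> bounded_op T;
  inorm_eq0 : forall (X Y : banachType R s) (T : X -> Y),
    inorm T = 0%E -> T = (fun=> 0);
  inormZ : forall (X Y : banachType R s) (a : K) (T : X -> Y),
    (inorm T < +oo)%E ->
    inorm (fun x => a *: T x) = ((scalar_re `|a|)%:E * inorm T)%E;
  inormD : forall (X Y : banachType R s) (S T : X -> Y),
    (inorm S < +oo)%E -> (inorm T < +oo)%E ->
    (inorm (fun x => S x + T x)%R <= inorm S + inorm T)%E;
  inorm_complete : forall (X Y : banachType R s) (T_ : nat -> X -> Y),
    (forall n, (inorm (T_ n) < +oo)%E) ->
    (forall e : R, 0 < e -> exists N, forall m n, (N <= m)%N -> (N <= n)%N ->
      (inorm (fun x => T_ m x - T_ n x)%R <= e%:E)%E) ->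
    exists2 T : X -> Y, (inorm T < +oo)%E &
      (fun n => inorm (fun x => T_ n x - T x)) @ \oo --> 0%E;
  inorm_comp : forall (W X Y Z : banachType R s)
      (u : W -> X) (T : X -> Y) (v : Y -> Z),
    bounded_op u -> (inorm T < +oo)%E -> bounded_op v ->
    (inorm (v \o T \o u) <= opnorm v * inorm T * opnorm u)%E;
  (* rank at most one: also puts the zero operator in the ideal *)
  inorm_rank1 : forall (X Y : banachType R s) (u : X -> Y),
    bounded_op u -> rank_lt 2 u -> inorm u = opnorm u
}.

Definition injective_ideal (A : banach_ideal) : Prop :=
  forall (X Y Y0 : banachType R s) (u : X -> Y) (J : Y -> Y0),
    bounded_op u -> isometric_injection J -> inorm A u = inorm A (J \o u).

Definition gelfand (n : nat) (X Y : banachType R s) (T : X -> Y) : \bar R :=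
  ereal_inf [set opnorm (T \o @incl _ _ E) | E in
    [set E : closed_subspace X | codim_lt n E]].

Definition ideal_gelfand (A : banach_ideal) (n : nat) (X Y : banachType R s)
    (T : X -> Y) : \bar R :=
  ereal_inf [set inorm A (T \o @incl _ _ E) | E in
    [set E : closed_subspace X | codim_lt n E]].

Definition ideal_approx (A : banach_ideal) (n : nat) (X Y : banachType R s)
    (T : X -> Y) : \bar R :=
  ereal_inf [set inorm A (fun x => T x - u x) | u in
    [set u : X -> Y | bounded_op u /\ rank_lt n u]].

End Operators.

Section TypeCotype.
Variables (R : realType) (s : scalars) (X : banachType R s).

(* The L_2 norm of the Rademacher sum [\sum_i e_i x_i], with the [e_i]
   independent uniform signs. *)
Definition rademacher (n : nat) (x : 'I_n -> X) : R :=
  Num.sqrt (((2 ^ n)%:R)^-1 * \sum_(e : {ffun 'I_n -> bool})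
    rnorm (\sum_(i < n) (-1) ^+ e i *: x i) ^+ 2).

Definition has_type (p : R) : Prop :=
  1 <= p <= 2 /\ exists C : R, forall (n : nat) (x : 'I_n -> X),
    rademacher x <= C * (\sum_(i < n) rnorm (x i) `^ p) `^ p^-1.

Definition has_cotype (q : R) : Prop :=
  2 <= q /\ exists C : R, forall (n : nat) (x : 'I_n -> X),
    (\sum_(i < n) rnorm (x i) `^ q) `^ q^-1 <= C * rademacher x.

Definition no_nontrivial_type : Prop := forall p : R, 1 < p -> ~ has_type p.

Definition no_nontrivial_cotype : Prop := forall q : R, ~ has_cotype q.

End TypeCotype.

Definition ceil_nat (x : rat) : nat := `|Num.ceil x|%N.

(* Main.v *)
(* A space without type has, for every [n], vectors whose Rademacher average is
   almost as large as possible, and these span a copy of [l_1^n]; dually a space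
   without cotype contains almost isometric copies of [l_infty^n], and norming
   functionals of the unit vectors of such a copy are almost biorthogonal to
   them (Maurey-Pisier).  Differences of pairs chosen by the pigeonhole principle
   make every new block of vectors and functionals of [X] almost orthogonal to
   the finitely many previous blocks.

   The operator is [T = \sum_j U_j], where [U_j] is a multiple of
   [n_j^-1 id : l_infty^(n_j) -> l_1^(n_j)] read through the blocks.  Each [U_j]
   is a sum of rank one operators with small total norm, which bounds every ideal
   norm of the tails from above.  From below, a subspace of codimension [k] of
   [l_infty^n] contains a vector of the unit ball with [n - k] unimodular
   coordinates, hence of [l_1] norm at least [n - k]. *)

From HB Require Import structures.
Require Import Defs.
From mathcomp Require Import all_boot all_order all_algebra.
From mathcomp Require Import complex ring lra zify.
From mathcomp Require Import all_classical all_reals all_analysis.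
Set Implicit Arguments.
Unset Strict Implicit.
Unset Printing Implicit Defensive.
Import Order.TTheory GRing.Theory Num.Theory.
Import numFieldNormedType.Exports.
Local Open Scope classical_set_scope.
Local Open Scope ring_scope.

(** * Real and complex scalars *)

(** One operator has to serve every ideal, so [T] is defined by convergence in the operator norm
    alone, and each ideal norm of its tails is bounded afterwards by one fixed real sequence [t].
    The weights face opposite demands: the tail from block [j] on must stay below 4 [alpha (M j)],
    yet the single weight of block [j] must reach [alpha (M j)]. For this the cut points [M j] are
    chosen so that [alpha] is halved after two of them, which makes the weights behave like a
    geometric series. If [alpha] decays fast, the cut points merely double; if it decays slowly, a
    block may become very long, but then [alpha] at its end is still at least half of its value at
    its beginning. In both cases [alpha (18 * m)] is at most twice [alpha (M j)] for the block [j]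
    that serves [m]. The lower constant is a product of losses: 1/2 for the unimodular coordinates
    and 1/3 for the copy of l_1 give 1/6; two errors of 1/48 leave 1/8; vectors of norm up to 3
    leave 1/24; the factor 2 above leaves 1/48. *)

Section Scalars.
Variables (R : realType) (s : scalars).
Local Notation K := (scalar_field R s).
Local Notation re := (@scalar_re R s).

(* [rl] embeds the reals into the scalars and [ab] is the modulus as a real
   number; over the real scalars [im] and [kI] are [0], so that [scalarE] holds
   in both cases. *)
Definition rl : R -> K :=
  match s return R -> scalar_field R s with
  | RealScalars => fun r => r
  | ComplexScalars => fun r => r%:C%C
  end.

Definition im : K -> R :=
  match s return scalar_field R s -> R with
  | RealScalars => fun=> 0
  | ComplexScalars => fun z => complex.Im z
  end.

Definition kI : K :=
  match s return scalar_field R s with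
  | RealScalars => 0
  | ComplexScalars => 'i%C
  end.

Definition ab (a : K) : R := re `|a|.

Lemma rlD a b : rl (a + b) = rl a + rl b.
Proof. by rewrite /rl; case: s => //; rewrite rmorphD. Qed.

Lemma rlM a b : rl (a * b) = rl a * rl b.
Proof. by rewrite /rl; case: s => //; rewrite rmorphM. Qed.

Lemma rlN a : rl (- a) = - rl a.
Proof. by rewrite /rl; case: s => //; rewrite rmorphN. Qed.

Lemma rl0 : rl 0 = 0.
Proof. by rewrite /rl; case: s. Qed.

Lemma rl1 : rl 1 = 1.
Proof. by rewrite /rl; case: s. Qed.

Lemma rl_nat n : rl n%:R = n%:R.
Proof. by elim: n => [|n ih]; rewrite ?rl0// -!natr1 rlD ih rl1. Qed.

Lemma rl_sign n : rl ((-1) ^+ n) = (-1) ^+ n.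
Proof.
by elim: n => [|n ih]; rewrite ?rl1// !exprS rlM ih rlN rl1.
Qed.

Lemma rl_le a b : (rl a <= rl b) = (a <= b).
Proof. by rewrite /rl; case: s => //; rewrite lecR. Qed.

Lemma rl_lt a b : (rl a < rl b) = (a < b).
Proof. by rewrite /rl; case: s => //; rewrite ltcR. Qed.

Lemma rl_inj : injective rl.
Proof. by rewrite /rl; case: s => // a b []. Qed.

Lemma reD a b : re (a + b) = re a + re b.
Proof. by move: a b; case: s => //= -[? ?] [? ?]. Qed.

Lemma reN a : re (- a) = - re a.
Proof. by move: a; case: s => //= -[? ?]. Qed.

Lemma re_rl r : re (rl r) = r.
Proof. by rewrite /rl; case: s. Qed.

Lemma re_rlM r a : re (rl r * a) = r * re a.
Proof. by rewrite /rl; move: a; case: s => //= -[? ?] /=; rewrite mul0r subr0. Qed.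

Lemma re_sum (I : Type) (r : seq I) (P : pred I) (F : I -> K) :
  re (\sum_(i <- r | P i) F i) = \sum_(i <- r | P i) re (F i).
Proof. by apply: (big_morph re reD); rewrite -[0]rl0 re_rl. Qed.

Lemma imD a b : im (a + b) = im a + im b.
Proof. by rewrite /im; move: a b; case: s => [a b|[? ?] [? ?]] //=; rewrite addr0. Qed.

Lemma im_rl r : im (rl r) = 0.
Proof. by rewrite /im /rl; case: s. Qed.

Lemma im_rlM r a : im (rl r * a) = r * im a.
Proof.
rewrite /im /rl; move: a; case: s => /= [a|[x y]] /=; first by rewrite mulr0.
by rewrite mul0r addr0.
Qed.

Lemma im_sum (I : Type) (r : seq I) (P : pred I) (F : I -> K) :
  im (\sum_(i <- r | P i) F i) = \sum_(i <- r | P i) im (F i).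
Proof. by apply: (big_morph im imD); rewrite -[0]rl0 im_rl. Qed.

Lemma scalarE a : a = rl (re a) + kI * rl (im a).
Proof.
rewrite /im /rl /kI; move: a; case: s => /= [a|[x y]]; first by rewrite mul0r addr0.
by apply/eqP; rewrite eq_complex /=; apply/andP; split; apply/eqP; ring.
Qed.

Lemma ge0_rl (a : K) : 0 <= a -> a = rl (re a).
Proof.
rewrite /rl; move: a; case: s => //= -[x y]; rewrite lecE /= => /andP[/eqP -> _].
by [].
Qed.

Lemma normE (a : K) : `|a| = rl (ab a).
Proof. exact: ge0_rl. Qed.

Lemma ab_sqr a : ab a ^+ 2 = re a ^+ 2 + im a ^+ 2.
Proof.
rewrite /ab /im; move: a; case: s => [a|a].
  by rewrite /= expr0n addr0 real_normK// num_real.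
by rewrite normc_def /= sqr_sqrtr// addr_ge0// sqr_ge0.
Qed.

Lemma ab_ge0 a : 0 <= ab a.
Proof. by rewrite -rl_le -normE rl0. Qed.

Lemma abM a b : ab (a * b) = ab a * ab b.
Proof. by apply: rl_inj; rewrite rlM -!normE normrM. Qed.

Lemma abD a b : ab (a + b) <= ab a + ab b.
Proof. by rewrite -rl_le rlD -!normE ler_normD. Qed.

Lemma abN a : ab (- a) = ab a.
Proof. by rewrite /ab normrN. Qed.

Lemma ab_rl r : ab (rl r) = `|r|.
Proof.
apply/eqP; rewrite -(@eqrXn2 _ 2)//; last exact: ab_ge0.
by rewrite ab_sqr re_rl im_rl expr0n addr0 real_normK// num_real.
Qed.

Lemma ab0 : ab 0 = 0.
Proof. by rewrite -rl0 ab_rl normr0. Qed.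

Lemma ab_eq0 a : ab a = 0 -> a = 0.
Proof. by move=> a0; apply/eqP; rewrite -normr_eq0 normE a0 rl0. Qed.

Lemma ab_sign n : ab ((-1) ^+ n) = 1.
Proof. by rewrite -rl_sign ab_rl normrX normrN1 expr1n. Qed.

Lemma ab_sum (I : Type) (r : seq I) (P : pred I) (F : I -> K) :
  ab (\sum_(i <- r | P i) F i) <= \sum_(i <- r | P i) ab (F i).
Proof.
elim/big_ind2: _ => //; first by rewrite ab0.
by move=> a b c d ab1 cd1; apply: le_trans (abD _ _) _; apply: lerD.
Qed.

Lemma re_le_ab a : `|re a| <= ab a.
Proof.
rewrite -(@ler_pXn2r _ 2)// ?nnegrE ?ab_ge0// ab_sqr real_normK ?num_real//.
by rewrite lerDl sqr_ge0.
Qed.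

Lemma im_le_ab a : `|im a| <= ab a.
Proof.
rewrite -(@ler_pXn2r _ 2)// ?nnegrE ?ab_ge0// ab_sqr real_normK ?num_real//.
by rewrite lerDr sqr_ge0.
Qed.

Lemma ab_le_re_im a : ab a <= `|re a| + `|im a|.
Proof.
rewrite -(@ler_pXn2r _ 2)// ?nnegrE ?ab_ge0 ?addr_ge0// ab_sqr sqrrD.
rewrite !real_normK ?num_real// lerD2r lerDl mulrn_wge0// mulr_ge0//.
Qed.

Lemma ab_subr_sqr a r : ab (a - rl r) ^+ 2 = ab a ^+ 2 - 2 * r * re a + r ^+ 2.
Proof.
rewrite !ab_sqr reD imD -rlN re_rl im_rl; ring.
Qed.

Lemma parallelogram a b :
  ab (a + b) ^+ 2 + ab (a - b) ^+ 2 = 2 * ab a ^+ 2 + 2 * ab b ^+ 2.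
Proof.
have imN : im (- b) = - im b.
  by have := imD b (- b); rewrite subrr -rl0 im_rl; lra.
by rewrite !ab_sqr !reD !imD reN imN; ring.
Qed.

End Scalars.

Arguments rl {R s}.
Arguments kI {R s}.

Section Rnorm.
Variables (R : realType) (s : scalars).
Local Notation K := (scalar_field R s).

Section OneSpace.
Variable X : normedModType K.
Implicit Types x y : X.

Lemma rnormE x : `|x| = rl (rnorm x).
Proof. exact: ge0_rl. Qed.

Lemma rnorm_ge0 x : 0 <= rnorm x.
Proof. by rewrite -(@rl_le R s) -rnormE rl0. Qed.

Lemma rnormD x y : rnorm (x + y) <= rnorm x + rnorm y.
Proof. by rewrite -(@rl_le R s) rlD -!rnormE ler_normD. Qed.

Lemma rnormZ (a : K) x : rnorm (a *: x) = ab a * rnorm x.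
Proof. by apply: (@rl_inj R s); rewrite rlM -!rnormE -normE normrZ. Qed.

Lemma rnorm_rlZ (r : R) x : rnorm ((rl r : K) *: x) = `|r| * rnorm x.
Proof. by rewrite rnormZ ab_rl. Qed.

Lemma rnormN x : rnorm (- x) = rnorm x.
Proof. by rewrite /rnorm normrN. Qed.

Lemma rnormB x y : rnorm (x - y) <= rnorm x + rnorm y.
Proof. by rewrite -[rnorm y]rnormN rnormD. Qed.

Lemma rnorm0 : rnorm (0 : X) = 0.
Proof. by apply: (@rl_inj R s); rewrite -rnormE normr0 rl0. Qed.

Lemma rnorm0_eq0 x : rnorm x = 0 -> x = 0.
Proof. by move=> x0; apply/eqP; rewrite -normr_eq0 rnormE x0 rl0. Qed.

Lemma rnorm_signZ n x : rnorm ((-1) ^+ n *: x) = rnorm x.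
Proof. by rewrite rnormZ ab_sign mul1r. Qed.

Lemma rnorm_sum (I : Type) (r : seq I) (P : pred I) (F : I -> X) :
  rnorm (\sum_(i <- r | P i) F i) <= \sum_(i <- r | P i) rnorm (F i).
Proof.
elim/big_ind2: _ => //; first by rewrite rnorm0.
by move=> a b c d ab1 cd1; apply: le_trans (rnormD _ _) _; apply: lerD.
Qed.

Lemma rnorm_distl x y : rnorm x - rnorm y <= rnorm (x - y).
Proof. by rewrite lerBlDr -{1}(subrK y x) rnormD. Qed.

End OneSpace.
End Rnorm.

(** * Norming functionals *)

Section HahnBanach.
Variables (R : realType) (s : scalars).
Local Notation K := (scalar_field R s).
Variable X : normedModType K.

Let rlZ (r : R) (x : X) : X := (rl r : K) *: x.

Let rlZD r t x : rlZ (r + t) x = rlZ r x + rlZ t x.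
Proof. by rewrite /rlZ rlD scalerDl. Qed.

Let rlZM r t x : rlZ (r * t) x = rlZ r (rlZ t x).
Proof. by rewrite /rlZ rlM scalerA. Qed.

Let rlZDr r x y : rlZ r (x + y) = rlZ r x + rlZ r y.
Proof. exact: scalerDr. Qed.

Let rlZ1 x : rlZ 1 x = x.
Proof. by rewrite /rlZ rl1 scale1r. Qed.

Let rlZ0 x : rlZ 0 x = 0.
Proof. by rewrite /rlZ rl0 scale0r. Qed.

(* Graph of a real-linear functional on a subspace, dominated by the norm;
   domination makes the graph single valued. *)
Definition dominated_graph (G : set (X * R)) : Prop :=
  [/\ forall x y a b, G (x, a) -> G (y, b) -> G (x + y, a + b),
      forall r x a, G (x, a) -> G (rlZ r x, r * a) &
      forall x a, G (x, a) -> a <= rnorm x].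

Lemma dominated_graph_functional G x a b : dominated_graph G ->
  G (x, a) -> G (x, b) -> a = b.
Proof.
move=> [GD GZ Gd] Ga Gb; apply/eqP; rewrite eq_le; apply/andP; split.
- have := Gd _ _ (GD _ _ _ _ Ga (GZ (-1) _ _ Gb)).
  by rewrite -{1}[x]rlZ1 -rlZD subrr rlZ0 rnorm0 mulN1r subr_le0.
- have := Gd _ _ (GD _ _ _ _ Gb (GZ (-1) _ _ Ga)).
  by rewrite -{1}[x]rlZ1 -rlZD subrr rlZ0 rnorm0 mulN1r subr_le0.
Qed.

(** By the triangle inequality every lower bound [a - rnorm (x - z)] for the value at [z] lies below
    every upper bound [rnorm (y + z) - b], so the supremum of the lower bounds is an admissible
    value. Negative and positive multiples of [z] use the two kinds of bounds. *)
Lemma dominated_graph_extend G z : dominated_graph G -> G !=set0 ->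
  exists2 G', dominated_graph G' & G `<=` G' /\ exists c, G' (z, c).
Proof.
move=> [GD GZ Gd] [[u0 a0] Gu0].
have G0 : G (0, 0) by have := GZ 0 _ _ Gu0; rewrite rlZ0 mul0r.
have sep x a y b : G (x, a) -> G (y, b) ->
    a - rnorm (x - z) <= rnorm (y + z) - b.
  move=> Ga Gb; rewrite lerBlDr addrAC lerBrDr.
  apply: le_trans (Gd _ _ (GD _ _ _ _ Ga Gb)) _.
  have -> : x + y = (y + z) + (x - z) by rewrite addrACA subrr addr0 addrC.
  exact: rnormD.
pose S := [set p.2 - rnorm (p.1 - z) | p in G].
have S0 : S !=set0 by exists (0 - rnorm (0 - z)), (0, 0).
have Sub y b : G (y, b) -> ubound S (rnorm (y + z) - b).
  by move=> Gb _ [[x a] Ga <-]; exact: sep.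
have hS : has_sup S by split=> //; exists (rnorm (0 + z) - 0); exact: Sub.
pose c := sup S.
have c_ge x a : G (x, a) -> a - rnorm (x - z) <= c.
  by move=> Ga; apply: ub_le_sup; [case: hS|exists (x, a)].
have c_le y b : G (y, b) -> c <= rnorm (y + z) - b.
  by move=> Gb; apply: ge_sup => //; exact: Sub.
exists [set p | exists x a t, G (x, a) /\ p = (x + rlZ t z, a + t * c)].
  split.
  - move=> _ _ _ _ [x [a [t [Ga [-> ->]]]]] [y [b [u [Gb [-> ->]]]]].
    exists (x + y), (a + b), (t + u); split; first exact: GD.
    by rewrite rlZD addrACA mulrDl [a + b + _]addrACA.
  - move=> r _ _ [x [a [t [Ga [-> ->]]]]].
    exists (rlZ r x), (r * a), (r * t); split; first exact: GZ.
    by rewrite rlZDr rlZM mulrDr mulrA.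
  - move=> _ _ [x [a [t [Ga [-> ->]]]]].
    have nz (u : R) (y : X) : 0 < u -> rnorm (rlZ u y) = u * rnorm y.
      by move=> up; rewrite rnorm_rlZ gtr0_norm.
    have [t0|t0|->] := ltgtP t 0; last first.
    - by rewrite rlZ0 mul0r !addr0; exact: Gd.
    - have := c_le _ _ (GZ t^-1 _ _ Ga).
      rewrite -(ler_pM2l t0) mulrBr -nz// rlZDr -rlZM mulrA.
      by rewrite divff ?gt_eqF// rlZ1 mul1r lerBrDl.
    - have up : 0 < - t by rewrite oppr_gt0.
      have := c_ge _ _ (GZ (- t)^-1 _ _ Ga).
      rewrite -(ler_pM2l up) mulrBr -nz// rlZDr -rlZM mulrA.
      rewrite divff ?gt_eqF// rlZ1 mul1r mulNr.
      have -> : rlZ (- t) (- z) = rlZ t z by rewrite /rlZ rlN scaleNr scalerN opprK.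
      lra.
split.
- by move=> [x a] Ga; exists x, a, 0; split=> //; rewrite rlZ0 mul0r !addr0.
- by exists c, 0, 0, 1; split=> //; rewrite rlZ1 mul1r !add0r.
Qed.

Lemma real_norming_functional (x0 : X) : exists h : X -> R,
  [/\ forall x y, h (x + y) = h x + h y,
      forall r x, h ((rl r : K) *: x) = r * h x,
      forall x, h x <= rnorm x & h x0 = rnorm x0].
Proof.
(* The condition at [x0] is guarded by nonemptiness because the empty chain has an empty union. A
   maximal graph is nonempty, since the line through [x0] would extend the empty one. *)
pose P : set (set (X * R)) := fun G =>
  dominated_graph G /\ (G !=set0 -> G (x0, rnorm x0)).
have [F FP Ftot|G [[GG Gx0] Gmax]] := @Zorn_bigcup (X * R)%type P.
  have two p q : (\bigcup_(G in F) G) p -> (\bigcup_(G in F) G) q ->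
      exists2 G, F G & G p /\ G q.
    move=> [A FA Ap] [B FB Bq].
    by have [AB|BA] := Ftot _ _ FA FB; [exists B|exists A] => //; split=> //;
      [apply: AB|apply: BA].
  split; [split|].
  - move=> x y a b Ux Uy; have [G FG [Gx Gy]] := two _ _ Ux Uy.
    by exists G => //; have [[GD _ _] _] := FP _ FG; exact: GD.
  - move=> r x a [G FG Gx].
    by exists G => //; have [[_ GZ _] _] := FP _ FG; exact: GZ.
  - by move=> x a [G FG Gx]; have [[_ _ Gd] _] := FP _ FG; exact: Gd.
  - by move=> [p [G FG Gp]]; exists G => //; apply: (FP _ FG).2; exists p.
have Gn0 : G !=set0.
  apply: contrapT => G0.
  have {}G0 p : ~ G p by move=> Gp; apply: G0; exists p.
  apply: (Gmax [set p | exists t, p = (rlZ t x0, t * rnorm x0)]).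
    split; first by move=> p /G0.
    by move=> /(_ (rlZ 1 x0, 1 * rnorm x0)) H; apply: (G0 _ (H _)); exists 1.
  split; last by move=> _; exists 1; rewrite rlZ1 mul1r.
  split.
  - by move=> _ _ _ _ [t [-> ->]] [u [-> ->]]; exists (t + u); rewrite rlZD mulrDl.
  - by move=> r _ _ [t [-> ->]]; exists (r * t); rewrite rlZM mulrA.
  - move=> _ _ [t [-> ->]]; rewrite rnorm_rlZ ler_wpM2r ?rnorm_ge0//.
    exact: ler_norm.
have Gtot x : exists a, G (x, a).
  apply: contrapT => nx.
  have [G' GG' [subG [c G'c]]] := dominated_graph_extend x GG Gn0.
  apply: (Gmax G').
    by split=> // sub; apply: nx; exists c; apply: sub.
  by split=> // _; apply: subG; exact: Gx0.
have [h hP] := choice Gtot.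
have hE x a : G (x, a) -> h x = a.
  by move=> Gx; exact: (dominated_graph_functional GG (hP x) Gx).
have [GD GZ Gd] := GG.
exists h; split.
- by move=> x y; apply: hE; exact: GD.
- by move=> r x; apply: hE; exact: GZ.
- by move=> x; exact: Gd.
- by apply: hE; exact: Gx0.
Qed.

End HahnBanach.

Section Functionals.
Variables (R : realType) (s : scalars).
Local Notation K := (scalar_field R s).
Variable X : normedModType K.

Record functional := Functional {
  fval :> X -> K;
  fvalD : forall x y, fval (x + y) = fval x + fval y;
  fvalZ : forall a x, fval (a *: x) = a * fval x;
  fval_le : forall x, ab (fval x) <= rnorm x
}.

Lemma fval_sum (f : functional) (I : Type) (r : seq I) (P : pred I) (F : I -> X) :
  f (\sum_(i <- r | P i) F i) = \sum_(i <- r | P i) f (F i).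
Proof.
by apply: (big_morph f (fvalD f)); rewrite -(scale0r 0) fvalZ mul0r.
Qed.

Lemma fvalB (f : functional) x y : f (x - y) = f x - f y.
Proof. by rewrite fvalD -scaleN1r fvalZ mulN1r. Qed.

(** A unimodular multiple of [x] makes the value of [f] equal to the nonnegative real [ab (f x)], so
    dominating the real part dominates the modulus. *)
Lemma functional_of_re (f : X -> K) :
  (forall x y, f (x + y) = f x + f y) -> (forall a x, f (a *: x) = a * f x) ->
  (forall x, scalar_re (f x) <= rnorm x) -> forall x, ab (f x) <= rnorm x.
Proof.
move=> fD fZ fre x.
have [->|fx0] := eqVneq (f x) 0; first by rewrite ab0 rnorm_ge0.
have abn0 : ab (f x) != 0 by apply: contra_neq fx0; exact: ab_eq0.
pose u : K := rl (ab (f x)) / f x.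
have uf : u * f x = rl (ab (f x)) by rewrite /u divfK.
have ab1 : ab u = 1.
  by apply: (mulIf abn0); rewrite -abM uf mul1r ab_rl ger0_norm// ab_ge0.
by have := fre (u *: x); rewrite fZ uf re_rl rnormZ ab1 mul1r.
Qed.

End Functionals.

(* A real-linear [h] is the real part of the complex-linear
   [x |-> h x - i h (i x)], and both have the same norm. *)
Lemma norming_functional (R : realType) (s : scalars)
    (X : normedModType (scalar_field R s)) (x0 : X) :
  exists f : functional X, f x0 = rl (rnorm x0).
Proof.
have [h [hD hZ hle h0]] := real_norming_functional x0.
suff [f [fD fZ fre]] : exists f : X -> scalar_field R s,
    [/\ forall x y, f (x + y) = f x + f y, forall a x, f (a *: x) = a * f x &
        forall x, scalar_re (f x) = h x].
  have fle := functional_of_re fD fZ.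
  have {}fle x : ab (f x) <= rnorm x by apply: fle => y; rewrite fre.
  exists (Functional fD fZ fle) => /=.
  have ab_r : ab (f x0) = rnorm x0.
    apply/eqP; rewrite eq_le fle /= -h0 -fre.
    by apply: le_trans (re_le_ab _); exact: ler_norm.
  have im0 : im (f x0) = 0.
    have := ab_sqr (f x0); rewrite ab_r fre h0 => /eqP.
    by rewrite eq_sym -subr_eq0 addrAC subrr add0r sqrf_eq0 => /eqP.
  by rewrite [f x0]scalarE im0 rl0 mulr0 addr0 fre h0.
case: s X x0 h hD hZ hle h0 => X x0 h hD hZ hle h0.
  by exists h; split.
have hN x : h (- x) = - h x by rewrite -scaleN1r -[-1]/(- 1%:C%C)%C -rmorphN hZ mulN1r.
exists (fun x => Complex (h x) (- h ('i%C *: x))); split => //.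
- move=> x y; rewrite scalerDr !hD; apply/eqP; rewrite eq_complex /= opprD !eqxx//.
- move=> [a b] x.
  have e : Complex a b = a%:C%C + 'i%C * b%:C%C :> R[i].
    by apply/eqP; rewrite eq_complex /=; apply/andP; split; apply/eqP; ring.
  have ii : ('i%C * 'i%C : R[i]) = - 1.
    by apply/eqP; rewrite eq_complex /=; apply/andP; split; apply/eqP; ring.
  rewrite e !scalerDl -!scalerA.
  have h1 : h ('i%C *: (b%:C%C *: x)) = b * h ('i%C *: x).
    by rewrite scalerA [_ * b%:C%C]mulrC -scalerA; exact: (hZ b).
  have h2 : h ('i%C *: (a%:C%C *: x)) = a * h ('i%C *: x).
    by rewrite scalerA [_ * a%:C%C]mulrC -scalerA; exact: (hZ a).
  have h3 : h ('i%C *: ('i%C *: (b%:C%C *: x))) = - (b * h x).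
    by rewrite scalerA ii scaleN1r hN; congr (- _); exact: (hZ b).
  rewrite scalerDr !hD h1 h2 h3 [h (a%:C%C *: x)](hZ a).
  by apply/eqP; rewrite eq_complex /=; apply/andP; split; apply/eqP; ring.
Qed.

(** * Rademacher averages *)

Section Averages.
Variable R : realType.

Definition avg (T : finType) (g : T -> R) : R := (#|T|%:R)^-1 * \sum_t g t.

Lemma avg_le (T : finType) (g h : T -> R) :
  (forall t, g t <= h t) -> avg g <= avg h.
Proof. by move=> gh; rewrite ler_wpM2l ?invr_ge0 ?ler0n ?ler_sum. Qed.

Lemma avg_ge0 (T : finType) (g : T -> R) : (forall t, 0 <= g t) -> 0 <= avg g.
Proof. by move=> g0; rewrite mulr_ge0 ?invr_ge0 ?ler0n ?sumr_ge0. Qed.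

Lemma eq_avg (T : finType) (g h : T -> R) : g =1 h -> avg g = avg h.
Proof. by move=> gh; congr (_ * _); apply: eq_bigr. Qed.

Lemma avg_const (T : finType) (c : R) : (0 < #|T|)%N -> avg (fun _ : T => c) = c.
Proof.
move=> T0; rewrite /avg sumr_const -[c *+ _]mulr_natl mulrA mulVf ?mul1r//.
by rewrite pnatr_eq0 -lt0n.
Qed.

Lemma avgD (T : finType) (g h : T -> R) :
  avg (fun t => g t + h t) = avg g + avg h.
Proof. by rewrite /avg big_split mulrDr. Qed.

Lemma avgZ (T : finType) (c : R) (g : T -> R) :
  avg (fun t => c * g t) = c * avg g.
Proof. by rewrite /avg -mulr_sumr mulrCA. Qed.

Lemma avg_sum (T I : finType) (g : I -> T -> R) :
  avg (fun t => \sum_i g i t) = \sum_i avg (g i).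
Proof. by rewrite /avg exchange_big mulr_sumr. Qed.

Lemma avg_exchange (T U : finType) (g : T -> U -> R) :
  avg (fun t => avg (g t)) = avg (fun u => avg (g^~ u)).
Proof.
rewrite /avg -!mulr_sumr exchange_big /= mulrCA.
by congr (_ * _).
Qed.

Lemma avg_bij (T : finType) (f : T -> T) (g : T -> R) :
  injective f -> avg (g \o f) = avg g.
Proof. by move=> fI; rewrite /avg; congr (_ * _); rewrite [RHS](reindex_inj fI). Qed.

Lemma card_signs_gt0 (I : finType) : (0 < #|{ffun I -> bool}|)%N.
Proof. by apply/card_gt0P; exists [ffun=> false]. Qed.

Definition signs_add (I : finType) (e d : {ffun I -> bool}) : {ffun I -> bool} :=
  [ffun i => e i (+) d i].

Lemma signs_add_inj (I : finType) (d : {ffun I -> bool}) :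
  injective (fun e => signs_add e d).
Proof.
move=> e e' /ffunP h; apply/ffunP => i.
by have := h i; rewrite !ffunE => /addIb.
Qed.

Lemma signs_addC (I : finType) (e d : {ffun I -> bool}) :
  signs_add e d = signs_add d e.
Proof. by apply/ffunP => i; rewrite !ffunE addbC. Qed.

Definition zero_ext (V : Type) (z : V) (I J : finType) (f : J -> I)
    (x : J -> V) (i : I) : V :=
  if [pick j | f j == i] is Some j then x j else z.

Lemma zero_extE (V : Type) (z : V) (I J : finType) (f : J -> I) (x : J -> V) j :
  injective f -> zero_ext z f x (f j) = x j.
Proof.
move=> fI; rewrite /zero_ext; case: pickP => [j' /eqP/fI -> //|/(_ j)].
by rewrite eqxx.
Qed.

Lemma zero_ext_out (V : Type) (z : V) (I J : finType) (f : J -> I) (x : J -> V) i :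
  i \notin codom f -> zero_ext z f x i = z.
Proof.
move=> ni; rewrite /zero_ext; case: pickP => // j /eqP e.
by rewrite -e codom_f in ni.
Qed.

(* Restricting uniform signs along an injection gives uniform signs. *)
Lemma avg_restrict (I J : finType) (f : J -> I) (h : {ffun J -> bool} -> R) :
  injective f -> avg (fun e : {ffun I -> bool} => h [ffun j => e (f j)]) = avg h.
Proof.
move=> fI; set g := fun e : {ffun I -> bool} => _.
pose lift (d : {ffun J -> bool}) : {ffun I -> bool} :=
  [ffun i => zero_ext false f d i].
have ge e d : g (signs_add e (lift d)) = h (signs_add [ffun j => e (f j)] d).
  rewrite /g; congr h; apply/ffunP => j; rewrite !ffunE.
  by rewrite (zero_extE _ _ _ fI).
(* Translating by [lift d] does not change the average over [e]; conversely, for fixed [e] the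
   restricted signs run through all of [{ffun J -> bool}] as [d] does. *)
transitivity (avg (fun d : {ffun J -> bool} => avg (fun e => g (signs_add e (lift d))))).
  rewrite -[LHS](@avg_const {ffun J -> bool}) ?card_signs_gt0//.
  apply: eq_avg => d; rewrite -[LHS](avg_bij _ (@signs_add_inj I (lift d))).
  by apply: eq_avg.
rewrite avg_exchange -[RHS](@avg_const {ffun I -> bool}) ?card_signs_gt0//.
apply: eq_avg => e.
rewrite -[RHS](avg_bij _ (@signs_add_inj J [ffun j => e (f j)])).
by apply: eq_avg => d; rewrite ge /= signs_addC.
Qed.

End Averages.

Lemma sum_codom (V : nmodType) (I J : finType) (f : J -> I) (G : I -> V) :
  injective f -> (forall i, i \notin codom f -> G i = 0) ->
  \sum_i G i = \sum_j G (f j).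
Proof.
move=> fI G0; rewrite (bigID [pred i | i \in codom f]) /=.
rewrite [X in _ + X]big1// addr0 -(@big_image _ _ _ _ _ f predT).
by rewrite big_uniq//; apply/injectiveP.
Qed.

Lemma exists_injection (I J : finType) : (#|J| <= #|I|)%N ->
  exists f : J -> I, injective f.
Proof.
move=> le; exists (fun j => enum_val (widen_ord le (enum_rank j))).
by move=> i j /enum_val_inj /(congr1 val) /= /val_inj /enum_rank_inj.
Qed.

Section Rademacher.
Variables (R : realType) (s : scalars).
Local Notation K := (scalar_field R s).
Variable X : banachType R s.

Definition rsum (I : finType) (x : I -> X) (e : {ffun I -> bool}) : X :=
  \sum_i (-1) ^+ e i *: x i.

(** Any finite index type is allowed so that products and subsets of index sets can be used
    directly. *)
Definition rad2 (I : finType) (x : I -> X) : R :=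
  avg (fun e => rnorm (rsum x e) ^+ 2).

Lemma rad2_ge0 (I : finType) (x : I -> X) : 0 <= rad2 x.
Proof. by apply: avg_ge0 => e; exact: sqr_ge0. Qed.

Lemma rademacherE (n : nat) (x : 'I_n -> X) : rademacher x = Num.sqrt (rad2 x).
Proof. by rewrite /rademacher /rad2 /avg card_ffun card_bool card_ord. Qed.

Lemma rad2_zero_ext (I J : finType) (f : J -> I) (x : J -> X) : injective f ->
  rad2 (zero_ext 0 f x) = rad2 x.
Proof.
move=> fI; rewrite /rad2 -[RHS](avg_restrict _ fI); apply: eq_avg => e.
congr (rnorm _ ^+ 2); rewrite /rsum (sum_codom fI).
  by apply: eq_bigr => j _; rewrite zero_extE// ffunE.
by move=> i ni; rewrite zero_ext_out// scaler0.
Qed.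

Lemma sum_zero_ext (I J : finType) (f : J -> I) (x : J -> X) : injective f ->
  \sum_i rnorm (zero_ext 0 f x i) ^+ 2 = \sum_j rnorm (x j) ^+ 2.
Proof.
move=> fI; rewrite (sum_codom fI).
  by apply: eq_bigr => j _; rewrite zero_extE.
by move=> i ni; rewrite zero_ext_out// rnorm0 expr0n.
Qed.

(** Multiplying the signs [e (i, j)] by further independent signs [d j] does not change their
    distribution; with [e] fixed, the sum is a Rademacher sum in [d] of the slices. *)
Lemma rad2_prod (I J : finType) (x : I * J -> X) :
  rad2 x = avg (fun e : {ffun I * J -> bool} =>
    rad2 (fun j => rsum (fun i => x (i, j)) [ffun i => e (i, j)])).
Proof.
pose d2 (d : {ffun J -> bool}) : {ffun I * J -> bool} := [ffun p => d p.2].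
rewrite /rad2 avg_exchange.
rewrite -[LHS](@avg_const _ {ffun J -> bool}) ?card_signs_gt0//.
apply: eq_avg => d; rewrite -[LHS](avg_bij _ (@signs_add_inj _ (d2 d))).
apply: eq_avg => e /=; congr (rnorm _ ^+ 2); rewrite /rsum.
under [RHS]eq_bigr do rewrite scaler_sumr.
rewrite exchange_big pair_bigA /=; apply: eq_bigr => -[i j] _ /=.
by rewrite !ffunE /= scalerA signr_addb mulrC.
Qed.

Lemma rad2_slice (I J : finType) (x : I * J -> X) (j : J) :
  avg (fun e : {ffun I * J -> bool} =>
    rnorm (rsum (fun i => x (i, j)) [ffun i => e (i, j)]) ^+ 2) =
  rad2 (fun i => x (i, j)).
Proof.
pose F (i : I) : I * J := (i, j).
rewrite /rad2 -(@avg_restrict _ _ _ F (fun e => rnorm (rsum _ e) ^+ 2))//.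
by move=> i i' [].
Qed.

(* The trivial constant in both bounds is [L = 1]; a constant [L < 1] for a
   single [n >= 2] already forces a nontrivial type (cotype), because the
   constants are submultiplicative in [n]. *)
Definition type_bound (n : nat) (L : R) : Prop := forall J : finType,
  (#|J| <= n)%N -> forall x : J -> X,
  rad2 x <= L * n%:R * \sum_j rnorm (x j) ^+ 2.

Definition cotype_bound (n : nat) (L : R) : Prop := forall J : finType,
  (#|J| <= n)%N -> forall x : J -> X,
  \sum_j rnorm (x j) ^+ 2 <= L * n%:R * rad2 x.

(** Padding with zero vectors changes neither side, so one index set with exactly [n] elements
    suffices. *)
Lemma type_bound_finType (n : nat) (L : R) (I : finType) : #|I| = n ->
  (forall x : I -> X, rad2 x <= L * n%:R * \sum_j rnorm (x j) ^+ 2) ->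
  type_bound n L.
Proof.
move=> In bnd J; rewrite -In => /exists_injection[f fI] x.
by have := bnd (zero_ext 0 f x); rewrite rad2_zero_ext// sum_zero_ext// In.
Qed.

Lemma cotype_bound_finType (n : nat) (L : R) (I : finType) : #|I| = n ->
  (forall x : I -> X, \sum_j rnorm (x j) ^+ 2 <= L * n%:R * rad2 x) ->
  cotype_bound n L.
Proof.
move=> In bnd J; rewrite -In => /exists_injection[f fI] x.
by have := bnd (zero_ext 0 f x); rewrite rad2_zero_ext// sum_zero_ext// In.
Qed.

(** The bound for [k] is applied to the slices with the signs [e] fixed and averaged over [e]; the
    bound for [n] then applies within each slice. *)
Lemma type_boundM (n k : nat) (L L' : R) : 0 <= L' ->
  type_bound n L -> type_bound k L' -> type_bound (n * k) (L * L').
Proof.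
move=> L0 hn hk; apply: (@type_bound_finType _ _ ('I_n * 'I_k)%type).
  by rewrite card_prod !card_ord.
move=> x; rewrite rad2_prod.
apply: (@le_trans _ _ (L' * k%:R * \sum_(j < k) rad2 (fun i => x (i, j)))).
  have -> : \sum_(j < k) rad2 (fun i => x (i, j)) =
      avg (fun e : {ffun 'I_n * 'I_k -> bool} => \sum_(j < k)
        rnorm (rsum (fun i => x (i, j)) [ffun i => e (i, j)]) ^+ 2).
    by rewrite avg_sum; apply: eq_bigr => j _; rewrite rad2_slice.
  by rewrite -avgZ; apply: avg_le => e; apply: hk; rewrite card_ord.
rewrite natrM mulrACA [X in _ <= X * _]mulrC -[leRHS]mulrA ler_wpM2l ?mulr_ge0//.
have -> : \sum_j rnorm (x j) ^+ 2 =
    \sum_(j < k) \sum_(i < n) rnorm (x (i, j)) ^+ 2.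
  by rewrite exchange_big pair_bigA; apply: eq_bigr => -[].
by rewrite mulr_sumr; apply: ler_sum => j _; apply: hn; rewrite card_ord.
Qed.

Lemma cotype_boundM (n k : nat) (L L' : R) : 0 <= L ->
  cotype_bound n L -> cotype_bound k L' -> cotype_bound (n * k) (L * L').
Proof.
move=> L0 hn hk; apply: (@cotype_bound_finType _ _ ('I_n * 'I_k)%type).
  by rewrite card_prod !card_ord.
move=> x.
apply: (@le_trans _ _ (L * n%:R * \sum_(j < k) rad2 (fun i => x (i, j)))).
  have -> : \sum_j rnorm (x j) ^+ 2 =
      \sum_(j < k) \sum_(i < n) rnorm (x (i, j)) ^+ 2.
    by rewrite exchange_big pair_bigA; apply: eq_bigr => -[].
  by rewrite mulr_sumr; apply: ler_sum => j _; apply: hn; rewrite card_ord.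
have -> : L * L' * (n * k)%:R * rad2 x = L * n%:R * (L' * k%:R * rad2 x).
  by rewrite natrM; ring.
rewrite ler_wpM2l ?mulr_ge0//.
have -> : \sum_(j < k) rad2 (fun i => x (i, j)) =
    avg (fun e : {ffun 'I_n * 'I_k -> bool} => \sum_(j < k)
      rnorm (rsum (fun i => x (i, j)) [ffun i => e (i, j)]) ^+ 2).
  by rewrite avg_sum; apply: eq_bigr => j _; rewrite rad2_slice.
by rewrite rad2_prod -avgZ; apply: avg_le => e; apply: hk; rewrite card_ord.
Qed.

Lemma type_boundX (n j : nat) (L : R) : 0 <= L ->
  type_bound n L -> type_bound (n ^ j.+1) (L ^+ j.+1).
Proof.
move=> L0 h; elim: j => [|j ih]; first by rewrite expn1 expr1.
by rewrite expnS exprS; apply: type_boundM => //; exact: exprn_ge0.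
Qed.

Lemma cotype_boundX (n j : nat) (L : R) : 0 <= L ->
  cotype_bound n L -> cotype_bound (n ^ j.+1) (L ^+ j.+1).
Proof.
move=> L0 h; elim: j => [|j ih]; first by rewrite expn1 expr1.
by rewrite expnS exprS; exact: cotype_boundM.
Qed.

End Rademacher.

(** * From Rademacher bounds to type and cotype *)

Lemma exists_pow_lt (R : realType) (rho e : R) : 0 <= rho < 1 -> 0 < e ->
  exists n, rho ^+ n < e.
Proof.
move=> /andP[rho0 rho1] e0.
have : rho ^+ n @[n --> \oo] --> 0 by apply: cvg_expr; rewrite ger0_norm.
move=> /cvgr0Pnorm_lt /(_ _ e0) [N _ HN]; exists N.
by apply: le_lt_trans (ler_norm _) _; apply: HN => /=.
Qed.

Lemma geometric_layer (R : realType) (rho B r : R) : 0 < rho < 1 -> 0 < r <= B ->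
  exists k, rho ^+ k.+1 * B < r <= rho ^+ k * B.
Proof.
move=> /andP[rho0 rho1] /andP[r0 rB].
have B0 : 0 < B by exact: lt_le_trans rB.
have ex : exists k, rho ^+ k.+1 * B < r.
  have [||n hn] := @exists_pow_lt R rho (r / B); first by rewrite rho1 ltW.
    exact: divr_gt0.
  exists n; rewrite -ltr_pdivlMr//; apply: le_lt_trans hn.
  by rewrite exprS ler_piMl ?exprn_ge0 ?ltW.
case: (ex_minnP ex) => k hk hmin; exists k; rewrite hk /=.
case: k hk hmin => [|k] _ hmin; first by rewrite expr0 mul1r.
by rewrite leNgt; apply/negP => /hmin; rewrite ltnn.
Qed.

Lemma geometric_layers (R : realType) (rho B : R) (I : finType) (r : I -> R) :
  0 < rho < 1 -> (forall i, 0 <= r i <= B) ->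
  exists (K : nat) (kappa : I -> 'I_K), forall i, r i != 0 ->
    rho ^+ (kappa i).+1 * B < r i <= rho ^+ kappa i * B.
Proof.
move=> hrho hr.
have /choice[kap kapP] : forall i, exists k, r i != 0 ->
    rho ^+ k.+1 * B < r i <= rho ^+ k * B.
  move=> i; have [->|ri0] := eqVneq (r i) 0; first by exists 0%N.
  have [ri rB] := andP (hr i).
  by have [|k hk] := @geometric_layer R rho B (r i) hrho; [rewrite lt0r ri0 ri|exists k].
pose K := (\max_i kap i).+1.
have kK i : (kap i < K)%N by rewrite ltnS (leq_bigmax i).
by exists K, (fun i => Ordinal (kK i)) => i; exact: kapP.
Qed.

(* Cauchy-Schwarz against the weights [2^-k]. *)
Lemma sqr_sum_le_weighted (R : realType) (K : nat) (a : nat -> R) :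
  (\sum_(k < K) a k) ^+ 2 <= 2 * \sum_(k < K) 2 ^+ k * a k ^+ 2.
Proof.
elim: K a => [|K ih] a; first by rewrite !big_ord0 expr0n mulr0.
have e (G : nat -> R) : \sum_(k < K.+1) G k = G 0%N + \sum_(k < K) G k.+1.
  by rewrite big_ord_recl.
rewrite (e a) (e (fun k => 2 ^+ k * a k ^+ 2)) expr0 mul1r.
under [X in _ <= 2 * (_ + X)]eq_bigr do rewrite exprS -mulrA.
rewrite -mulr_sumr; have := ih (fun k => a k.+1).
move: (\sum_(k < K) a k.+1) (\sum_(k < K) _ * _) (a 0%N) => S W b hS.
have := sqr_ge0 (b - S); lra.
Qed.

Lemma sum_half_pow (R : realType) (K : nat) : \sum_(k < K) (2^-1 : R) ^+ k <= 2.
Proof.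
suff -> : \sum_(k < K) (2^-1 : R) ^+ k = 2 - 2 * 2^-1 ^+ K.
  by rewrite lerBlDr lerDl mulr_ge0// exprn_ge0.
elim: K => [|K ih]; first by rewrite big_ord0 expr0; lra.
by rewrite big_ord_recr /= ih exprS; lra.
Qed.

Lemma half_sqr_le (R : realType) (u v w : R) : 0 <= u -> u <= v + w ->
  (2^-1 * u) ^+ 2 <= 2^-1 * v ^+ 2 + 2^-1 * w ^+ 2.
Proof.
move=> u0 uvw; have : u ^+ 2 <= (v + w) ^+ 2.
  by rewrite ler_pXn2r ?nnegrE//; exact: le_trans u0 uvw.
have := sqr_ge0 (v - w); lra.
Qed.

Section BoundsToTypes.
Variables (R : realType) (s : scalars) (X : banachType R s).

(** A partial sum is the mean of the full sum and the sum with the signs outside the image of [f]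
    flipped. Both have the same distribution, and the square is convex. *)
Lemma rad2_injection (I J : finType) (f : J -> I) (x : I -> X) : injective f ->
  rad2 (x \o f) <= rad2 x.
Proof.
move=> fI; rewrite /rad2 -(avg_restrict _ fI).
pose d : {ffun I -> bool} := [ffun i => i \notin codom f].
apply: (@le_trans _ _ (avg (fun e => 2^-1 * (rnorm (rsum x e) ^+ 2)
   + 2^-1 * (rnorm (rsum x (signs_add e d)) ^+ 2)))); last first.
  rewrite avgD !avgZ.
  have -> := avg_bij (fun e => rnorm (rsum x e) ^+ 2) (@signs_add_inj I d).
  by move: (avg _) => u; lra.
apply: avg_le => e.
have -> : rsum (x \o f) [ffun j => e (f j)] =
    (rl 2^-1 : scalar_field R s) *: (rsum x e + rsum x (signs_add e d)).
  rewrite /rsum -big_split /= scaler_sumr (sum_codom fI).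
    apply: eq_bigr => j _; rewrite !ffunE codom_f /= addbF -scalerDl scalerA.
    congr (_ *: _); rewrite -[_ ^+ _]mul1r -mulrDl mulrA -rl1 -rlD -rlM.
    by rewrite mulVf ?rl1 ?mul1r// pnatr_eq0.
  move=> i ni; rewrite !ffunE ni addbT -scalerDl signrN subrr.
  by rewrite scale0r scaler0.
rewrite rnorm_rlZ ger0_norm//; apply: half_sqr_le; first exact: rnorm_ge0.
exact: rnormD.
Qed.

Lemma rnorm_le_rad2 (I : finType) (x : I -> X) i : rnorm (x i) ^+ 2 <= rad2 x.
Proof.
have -> : rnorm (x i) ^+ 2 = rad2 (x \o (fun _ : unit => i)).
  rewrite /rad2 -[LHS](@avg_const _ {ffun unit -> bool}) ?card_signs_gt0//.
  apply: eq_avg => e; rewrite /rsum (big_pred1 tt); last by case.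
  by rewrite rnorm_signZ.
by apply: rad2_injection; case; case.
Qed.

Lemma cotype_bound1 n : cotype_bound X n 1.
Proof.
move=> J Jn x; rewrite mul1r.
apply: (@le_trans _ _ (\sum_(j : J) rad2 x)).
  by apply: ler_sum => j _; exact: rnorm_le_rad2.
by rewrite sumr_const -[X in X <= _]mulr_natl ler_wpM2r ?rad2_ge0// ler_nat.
Qed.

(** [N] vectors of norm above [t] would have a sum of squares above [N * t ^+ 2], more than the
    bound for these [N] vectors permits. *)
Lemma cotype_count (I : finType) (x : I -> X) (N : nat) (t : R) (L : R) :
  (0 < N)%N -> 0 <= L -> cotype_bound X N L -> L * rad2 x <= t ^+ 2 -> 0 <= t ->
  (#|[set i | (t < rnorm (x i))%R]%SET| < N)%N.
Proof.
move=> N0 L0 hN ht t0; rewrite ltnNge; apply/negP.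
set A := [set i | _]%SET => NA.
have [|g gI] := @exists_injection {i | i \in A} 'I_N.
  by rewrite card_sig card_ord.
pose f := val \o g.
have fI : injective f by apply: inj_comp => //; exact: val_inj.
have := hN 'I_N _ (x \o f); rewrite card_ord => /(_ (leqnn _)).
apply/negP; rewrite -ltNge.
apply: (@le_lt_trans _ _ (N%:R * t ^+ 2)).
  apply: (@le_trans _ _ (L * N%:R * rad2 x)).
    by rewrite ler_wpM2l ?mulr_ge0// rad2_injection.
  by rewrite [L * _]mulrC -mulrA ler_wpM2l.
rewrite mulr_natl -[X in _ *+ X](card_ord N) -sumr_const.
apply: ltr_sum.
  by apply/hasP; exists (Ordinal N0); rewrite ?mem_index_enum.
move=> j _; rewrite ltr_pXn2r ?nnegrE ?rnorm_ge0//.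
by have := valP (g j); rewrite inE.
Qed.

End BoundsToTypes.

Section BoundsToCotype.
Variables (R : realType) (s : scalars) (X : banachType R s).

(** Fewer than [N ^ k.+1] norms lie between [B / 2 ^ k.+1] and [B / 2 ^ k], by [cotype_count] with
    constant [4^-1 ^+ k.+1]. This layer contributes at most [N * B ^+ q * (N / 2 ^ q) ^+ k], and
    [N / 2 ^ q] is at most 1/2. *)
Lemma sum_pow_le (N q : nat) (I : finType) (x : I -> X) (B : R) :
  (0 < N)%N -> (2 * N <= 2 ^ q)%N -> 0 <= B -> B ^+ 2 = rad2 x ->
  (forall k, cotype_bound X (N ^ k) (4^-1 ^+ k)) ->
  \sum_i rnorm (x i) ^+ q <= 2 * N%:R * B ^+ q.
Proof.
move=> N0 Nq B0 BE hN.
have xB i : 0 <= rnorm (x i) <= B.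
  rewrite rnorm_ge0 -(@ler_pXn2r _ 2)// ?nnegrE ?rnorm_ge0// BE.
  exact: rnorm_le_rad2.
have half01 : 0 < (2^-1 : R) < 1 by lra.
have q0 : (0 < q)%N by case: q Nq => //; rewrite expn0; lia.
have [K [kap kapP]] := geometric_layers half01 xB.
rewrite (partition_big kap xpredT)//=.
apply: (@le_trans _ _ (\sum_(k < K) N%:R * B ^+ q * 2^-1 ^+ k)); last first.
  have -> : 2 * N%:R * B ^+ q = N%:R * B ^+ q * 2 by ring.
  rewrite -mulr_sumr ler_wpM2l ?mulr_ge0 ?exprn_ge0//; exact: sum_half_pow.
apply: ler_sum => k _.
rewrite (bigID [pred i | rnorm (x i) != 0]) /= addrC big1 ?add0r; last first.
  by move=> i /andP[_ /negPn/eqP ->]; rewrite expr0n gtn_eqF.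
pose t := 2^-1 ^+ k.+1 * B.
pose A := [set i | t < rnorm (x i)]%SET.
have cA : (#|A| < N ^ k.+1)%N.
  apply: (@cotype_count _ _ _ _ _ _ _ (4^-1 ^+ k.+1)) => //.
  - by rewrite expn_gt0 N0.
  - by rewrite -BE /t exprMn -exprM mulnC exprM; have -> : (2^-1 : R) ^+ 2 = 4^-1 by lra.
  - by rewrite /t mulr_ge0// exprn_ge0.
apply: (@le_trans _ _ (\sum_(i in A) (2^-1 ^+ k * B) ^+ q)).
  rewrite [leLHS]big_mkcond [leRHS]big_mkcond; apply: ler_sum => i _.
  case: ifP => [/andP[/eqP ki xi0]|_]; last first.
    by case: ifP => // _; rewrite exprn_ge0// mulr_ge0// exprn_ge0.
  have := kapP _ xi0; rewrite ki => /andP[lo hi].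
  by rewrite inE /t lo ler_pXn2r ?nnegrE ?rnorm_ge0 ?mulr_ge0 ?exprn_ge0.
have Nq' : N%:R * 2^-1 ^+ q <= (2^-1 : R).
  rewrite exprVn ler_pdivrMr ?exprn_gt0// -natrX.
  have : ((2 * N)%:R : R) <= (2 ^ q)%:R by rewrite ler_nat.
  by rewrite natrM; lra.
rewrite sumr_const -[leLHS]mulr_natl.
apply: (@le_trans _ _ ((N ^ k.+1)%:R * (2^-1 ^+ k * B) ^+ q)).
  by rewrite ler_wpM2r ?ler_nat ?(ltnW cA)// exprn_ge0// mulr_ge0// exprn_ge0.
have -> : (N ^ k.+1)%:R * (2^-1 ^+ k * B) ^+ q =
    N%:R * B ^+ q * (N%:R * 2^-1 ^+ q) ^+ k.
  by rewrite natrX exprS exprMn -exprM mulnC exprM [in RHS]exprMn; ring.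
rewrite ler_wpM2l ?mulr_ge0 ?exprn_ge0//.
by apply: lerXn2r => //; rewrite nnegrE ?mulr_ge0 ?exprn_ge0.
Qed.

Lemma has_cotype_of_bound (n : nat) (L : R) : (0 < n)%N -> L < 1 ->
  cotype_bound X n L -> exists q : R, has_cotype X q.
Proof.
move=> n0 L1 hL.
(* Powers of the constant are taken below, and [L] may be negative. *)
pose L' := Num.max L 0.
have L'0 : 0 <= L' by rewrite le_max lexx orbT.
have hL' : cotype_bound X n L'.
  move=> J Jn x; apply: le_trans (hL J Jn x) _.
  rewrite -!mulrA; apply: ler_wpM2r; last by rewrite le_max lexx.
  by apply: mulr_ge0 => //; exact: rad2_ge0.
have [||j hj] := @exists_pow_lt R L' 4^-1.
- by rewrite L'0 gt_max L1 ltr01.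
- by rewrite invr_gt0.
pose N := (n ^ j.+1)%N.
have N0 : (0 < N)%N by rewrite expn_gt0 n0.
have hN : cotype_bound X N 4^-1.
  move=> J Jn x; apply: le_trans (cotype_boundX (j := j) L'0 hL' Jn x) _.
  rewrite -!mulrA; apply: ler_wpM2r.
    by apply: mulr_ge0 => //; exact: rad2_ge0.
  apply: le_trans (ltW hj); rewrite exprS ler_piMl ?exprn_ge0//.
  by rewrite ge_max ler01 ltW.
have hNk k : cotype_bound X (N ^ k) (4^-1 ^+ k).
  case: k => [|k]; first by rewrite expr0; exact: cotype_bound1.
  by apply: cotype_boundX.
(* Any [q] at least 2 with [2 * N <= 2 ^ q] would do. *)
pose q := (2 * N)%N.
have qR : (q%:R : R) != 0 by rewrite pnatr_eq0 /q muln_eq0 negb_or -!lt0n N0.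
exists q%:R; split; first by rewrite (ler_nat _ 2) /q; lia.
exists ((2 * N%:R) `^ (q%:R)^-1) => m x.
have B0 : 0 <= rademacher x by exact: sqrtr_ge0.
have BE : rademacher x ^+ 2 = rad2 x by rewrite rademacherE sqr_sqrtr// rad2_ge0.
have Nq : (2 * N <= 2 ^ q)%N by exact: ltnW (ltn_expl _ _).
have := sum_pow_le N0 Nq B0 BE hNk.
under [X in _ -> X `^ _ <= _]eq_bigr do rewrite powR_mulrn ?rnorm_ge0//.
move=> h; have q0 : 0 <= (q%:R : R)^-1 by rewrite invr_ge0.
have -> : (2 * N%:R) `^ q%:R^-1 * rademacher x =
    (2 * N%:R * rademacher x ^+ q) `^ q%:R^-1.
  rewrite [in RHS]powRM ?exprn_ge0 ?mulr_ge0//; congr (_ * _).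
  by rewrite -powR_mulrn// -powRrM mulfV// powRr1.
apply: (ge0_ler_powR q0) => //; rewrite nnegrE.
  by rewrite sumr_ge0// => i _; rewrite exprn_ge0// rnorm_ge0.
by rewrite mulr_ge0// exprn_ge0.
Qed.

End BoundsToCotype.

Section BoundsToType.
Variables (R : realType) (s : scalars) (X : banachType R s).

Lemma rsum_sum (I : finType) (K : nat) (x : I -> X) (y : 'I_K -> I -> X) e :
  (forall i, x i = \sum_k y k i) -> rsum x e = \sum_k rsum (y k) e.
Proof.
move=> h; rewrite /rsum exchange_big; apply: eq_bigr => i _.
by rewrite h scaler_sumr.
Qed.

Lemma rad2_sum (I : finType) (K : nat) (x : I -> X) (y : nat -> I -> X) :
  (forall i, x i = \sum_(k < K) y k i) ->
  rad2 x <= 2 * \sum_(k < K) 2 ^+ k * rad2 (y k).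
Proof.
move=> h; rewrite mulr_sumr.
have -> : \sum_(k < K) 2 * (2 ^+ k * rad2 (y k)) =
    avg (fun e => 2 * \sum_(k < K) 2 ^+ k * rnorm (rsum (y k) e) ^+ 2).
  rewrite avgZ avg_sum mulr_sumr; apply: eq_bigr => k _.
  by rewrite avgZ.
apply: avg_le => e.
rewrite (rsum_sum (y := fun k => y k) _ h).
apply: le_trans (sqr_sum_le_weighted K (fun k => rnorm (rsum (y k) e))).
by rewrite ler_pXn2r ?nnegrE ?rnorm_ge0 ?sumr_ge0 ?rnorm_sum// => k _; rewrite rnorm_ge0.
Qed.

Lemma rad2_restrict_le (I : finType) (x : I -> X) (P : pred I) (N : nat) (L t : R) :
  0 <= L -> type_bound X N L -> (#|[set i | P i]%SET| <= N)%N ->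
  (forall i, P i -> rnorm (x i) <= t) ->
  rad2 (fun i => if P i then x i else 0) <= L * N%:R ^+ 2 * t ^+ 2.
Proof.
move=> L0 hN cA xt; set A := [set i | P i]%SET in cA *.
pose f : {i | i \in A} -> I := val.
have fI : injective f by exact: val_inj.
have -> : (fun i => if P i then x i else 0) = zero_ext 0 f (x \o f).
  apply/funext => i; case: ifPn => Pi.
    have iA : i \in A by rewrite inE.
    by rewrite -[ i ]/(f (exist _ i iA)) zero_extE.
  rewrite zero_ext_out//; apply/codomP => -[[j /= jA] ij].
  have : j \in A by [].
  by rewrite inE; rewrite ij /f /= in Pi; rewrite (negPf Pi).
rewrite rad2_zero_ext//.
have cA' : (#|{: {i | i \in A}}| <= N)%N by rewrite card_sig.
apply: le_trans (hN _ cA' _) _.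
have -> : L * N%:R ^+ 2 * t ^+ 2 = L * N%:R * (N%:R * t ^+ 2) by ring.
rewrite ler_wpM2l ?mulr_ge0//.
apply: (@le_trans _ _ (\sum_(u : {i | i \in A}) t ^+ 2)).
  apply: ler_sum => u _; have := valP u; rewrite inE => Pu.
  have xu := xt _ Pu; have t0 : 0 <= t := le_trans (rnorm_ge0 _) xu.
  by rewrite ler_pXn2r ?nnegrE ?rnorm_ge0.
by rewrite sumr_const -[leLHS]mulr_natl ler_wpM2r ?sqr_ge0// ler_nat.
Qed.

(** The family is cut into layers of norms between [rho ^+ k.+1 * sigma] and [rho ^+ k * sigma]. As
    [rho] to the power [p] is [1 / N], layer [k] has at most [N ^ k.+1] members, and the type bound
    applies to it. With the weight [2 ^+ k] of [rad2_sum], the layers decrease with ratio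
    [2 / 16 * (rho * N) ^+ 2], at most 1/2: this is where the constant 16 comes from. *)
Lemma rad2_le_of_bound (N : nat) (p rho sigma : R) (I : finType) (x : I -> X) :
  1 <= p -> 0 < rho < 1 -> rho * N%:R <= 2 -> rho `^ p = N%:R^-1 ->
  (0 < N)%N -> sigma `^ p = \sum_i rnorm (x i) `^ p -> 0 <= sigma ->
  (forall k, type_bound X (N ^ k.+1) (16^-1 ^+ k.+1)) ->
  rad2 x <= (N%:R * sigma) ^+ 2.
Proof.
move=> p1 hrho rhoN rhop N0 sigmap sigma0 hN.
have p0 : 0 < p by lra.
have pow_ge0 i : 0 <= rnorm (x i) `^ p by exact: powR_ge0.
have xs i : 0 <= rnorm (x i) <= sigma.
  rewrite rnorm_ge0 /=; rewrite leNgt; apply/negP => /(gt0_ltr_powR p0).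
  rewrite !nnegrE sigma0 rnorm_ge0 => /(_ isT isT); apply/negP.
  by rewrite -leNgt sigmap (bigD1 i)//= lerDl sumr_ge0.
have [K [kap kapP]] := geometric_layers hrho xs.
have [rho0 rho1] := andP hrho.
pose P k i := (kap i == k :> nat) && (rnorm (x i) != 0).
pose y k i : X := if P k i then x i else 0.
have xy i : x i = \sum_(k < K) y k i.
  rewrite (bigD1 (kap i))//= big1 ?addr0 /y /P ?eqxx /=; last first.
    by move=> k /negPf ki; rewrite eq_sym -val_eqE /= in ki; rewrite ki.
  by case: eqVneq => // /rnorm0_eq0.
apply: le_trans (rad2_sum xy) _.
apply: (@le_trans _ _ (2 * \sum_(k < K) (N%:R ^+ 2 / 16 * sigma ^+ 2 * 2^-1 ^+ k))).
  rewrite ler_pM2l//; apply: ler_sum => k _.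
  have hyi i : P k i -> rnorm (x i) <= rho ^+ k * sigma.
    by move=> /andP[/eqP ki xi0]; have := kapP _ xi0; rewrite ki => /andP[].
  have cA : (#|[set i | P k i]%SET| <= N ^ k.+1)%N.
    set A := [set i | _]%SET.
    have [s0|sn0] := eqVneq sigma 0.
      rewrite eq_card0// => i.
      rewrite !inE /P; have := xs i; rewrite s0 -eq_le => /eqP ->.
      by rewrite eqxx andbF.
    have sp : 0 < sigma `^ p by rewrite powR_gt0// lt0r sn0.
    suff : #|A|%:R * (N%:R^-1 ^+ k.+1 * sigma `^ p) <= sigma `^ p.
      rewrite mulrA -[leRHS]mul1r ler_pM2r// exprVn ler_pdivrMr ?exprn_gt0 ?ltr0n//.
      by rewrite mul1r -natrX ler_nat.
    rewrite [leRHS]sigmap mulr_natl -sumr_const.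
    rewrite [leLHS]big_mkcond; apply: ler_sum => i _.
    case: ifP => //; rewrite inE => /andP[/eqP ki xi0].
    have := kapP _ xi0; rewrite ki => /andP[lo _].
    have -> : N%:R^-1 ^+ k.+1 * sigma `^ p = (rho ^+ k.+1 * sigma) `^ p.
      rewrite powRM ?exprn_ge0 ?(ltW rho0)// -rhop; congr (_ * _).
      by rewrite -!powR_mulrn ?powR_ge0 ?(ltW rho0)// -!powRrM mulrC.
    apply: (ge0_ler_powR (ltW p0)); last exact: ltW.
      by rewrite nnegrE mulr_ge0 ?exprn_ge0 ?(ltW rho0).
    by rewrite nnegrE rnorm_ge0.
  have L0 : 0 <= (16^-1 : R) ^+ k.+1 by rewrite exprn_ge0.
  have := rad2_restrict_le L0 (hN k) cA hyi.
  rewrite -/(y k) => h.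
  apply: (@le_trans _ _ (2 ^+ k * (16^-1 ^+ k.+1 * (N ^ k.+1)%:R ^+ 2 * (rho ^+ k * sigma) ^+ 2))).
    by rewrite ler_wpM2l ?exprn_ge0.
  have -> : 2 ^+ k * (16^-1 ^+ k.+1 * (N ^ k.+1)%:R ^+ 2 * (rho ^+ k * sigma) ^+ 2)
     = N%:R ^+ 2 / 16 * sigma ^+ 2 * ((2 / 16) * (rho * N%:R) ^+ 2) ^+ k.
    by rewrite natrX !expr2 !exprMn !exprS; ring.
  rewrite ler_wpM2l ?mulr_ge0 ?sqr_ge0//.
  apply: lerXn2r; rewrite ?nnegrE ?mulr_ge0 ?sqr_ge0 ?(ltW rho0)//.
  have : (rho * N%:R) ^+ 2 <= 2 ^+ 2.
    by rewrite ler_pXn2r ?nnegrE ?mulr_ge0 ?(ltW rho0).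
  lra.
rewrite -mulr_sumr exprMn; have := sum_half_pow R K.
have : 0 <= N%:R ^+ 2 * sigma ^+ 2 by rewrite mulr_ge0 ?sqr_ge0.
set u := N%:R ^+ 2 * sigma ^+ 2 => u0 hS.
have -> : N%:R ^+ 2 / 16 * sigma ^+ 2 = u / 16 by rewrite /u; ring.
nra.
Qed.

Lemma has_type_of_bound (n : nat) (L : R) : (1 < n)%N -> L < 1 ->
  type_bound X n L -> exists2 p : R, 1 < p & has_type X p.
Proof.
move=> n1 L1 hL.
pose L' := Num.max L 0.
have L'0 : 0 <= L' by rewrite le_max lexx orbT.
have hL' : type_bound X n L'.
  move=> J Jn x; apply: le_trans (hL J Jn x) _.
  rewrite -!mulrA; apply: ler_wpM2r; last by rewrite le_max lexx.
  by apply: mulr_ge0 => //; apply: sumr_ge0 => j _; exact: sqr_ge0.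
have [||j hj] := @exists_pow_lt R L' 16^-1.
- by rewrite L'0 gt_max L1 ltr01.
- by rewrite invr_gt0.
pose N := (n ^ j.+1)%N.
have N1 : (1 < N)%N by rewrite -(exp1n j.+1) ltn_exp2r.
have hN : type_bound X N 16^-1.
  move=> J Jn x; apply: le_trans (type_boundX (j := j) L'0 hL' Jn x) _.
  rewrite -!mulrA; apply: ler_wpM2r.
    by apply: mulr_ge0 => //; apply: sumr_ge0 => i _; exact: sqr_ge0.
  apply: le_trans (ltW hj); rewrite exprS ler_piMl ?exprn_ge0//.
  by rewrite ge_max ler01 ltW.
have hNk k : type_bound X (N ^ k.+1) (16^-1 ^+ k.+1) by exact: type_boundX.
(* With this exponent, [rho], the power [- p^-1] of [N], satisfies [rho * N] = N^(1/N), which is at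
   most 2 because [N <= 2 ^ N]. *)
pose p : R := (1 - N%:R^-1)^-1.
have N2 : 2 <= (N%:R : R) by rewrite (ler_nat _ 2).
have Nv : 0 < (N%:R : R)^-1 <= 2^-1.
  by rewrite invr_gt0 lef_pV2 ?posrE ?N2 ?andbT; lra.
have p1 : 1 < p by rewrite /p invf_gt1; lra.
have p2 : p <= 2 by rewrite /p -[leRHS]invrK lef_pV2 ?posrE; lra.
exists p => //; split; first by rewrite (ltW p1).
exists N%:R => m x.
have pn0 : p != 0 by lra.
set S := \sum_i _.
have S0 : 0 <= S by apply: sumr_ge0 => i _; exact: powR_ge0.
pose rho : R := N%:R `^ (- p^-1).
have NR0 : (N%:R : R) != 0 by lra.
have h : rad2 x <= (N%:R * S `^ p^-1) ^+ 2.
  apply: (@rad2_le_of_bound N p rho) => //.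
  - exact: ltW.
  - rewrite /rho powR_gt0 ?ltr0n ?(ltnW N1)//=.
    rewrite powRN invf_lt1 ?powR_gt0 ?ltr0n ?(ltnW N1)//.
    have pV0 : 0 < p^-1 by rewrite invr_gt0; lra.
    have := @gt0_ltr_powR R _ pV0 1 N%:R; rewrite powR1 !nnegrE; apply; lra.
  - rewrite /rho -{2}[N%:R]powRr1// -powRD ?NR0 ?implybT// /p invrK.
    have -> : - (1 - N%:R^-1) + 1 = N%:R^-1 :> R by lra.
    have -> : 2 = (2 ^+ N) `^ N%:R^-1 :> R.
      by rewrite -powR_mulrn// -powRrM divff// powRr1.
    apply: ge0_ler_powR; rewrite ?nnegrE ?exprn_ge0//.
    by rewrite -natrX ler_nat ltnW// ltn_expl.
  - by rewrite /rho -powRrM mulNr mulVf// powR_inv1.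
  - exact: ltnW.
  - by rewrite -powRrM mulVf// powRr1.
  - exact: powR_ge0.
rewrite rademacherE -[leRHS]ger0_norm ?mulr_ge0 ?powR_ge0// -sqrtr_sqr.
exact: ler_wsqrtr.
Qed.

End BoundsToType.

(** * Copies of l_1^n in spaces without type *)

Section Auxiliary.
Variable R : realType.

Lemma sqr_sum_le_card (I : finType) (r : I -> R) :
  (\sum_i r i) ^+ 2 <= #|I|%:R * \sum_i r i ^+ 2.
Proof.
have [I0|I0] := posnP #|I|.
  by rewrite !big_pred0 ?expr0n ?mulr0// => i; have := card0_eq I0 i.
set S := \sum_i r i; set Q := \sum_i _; set n : R := #|I|%:R.
have n0 : 0 < n by rewrite ltr0n.
have : 0 <= \sum_i (n * r i - S) ^+ 2 by apply: sumr_ge0 => i _; exact: sqr_ge0.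
have -> : \sum_i (n * r i - S) ^+ 2 = n * (n * Q - S ^+ 2).
  transitivity (\sum_i (n ^+ 2 * r i ^+ 2 - 2 * n * S * r i + S ^+ 2)).
    by apply: eq_bigr => i _; ring.
  have e : \sum_(i : I) S ^+ 2 = n * S ^+ 2 by rewrite sumr_const mulr_natl.
  by rewrite big_split sumrB /= e -!mulr_sumr -/S -/Q; ring.
by rewrite pmulr_rge0// subr_ge0.
Qed.

(** No value exceeds [M], so the whole deficit of the sum bounds the deficit of each single value.
    This turns near-extremality on average into near-extremality for every choice of signs. *)
Lemma avg_extremal (T : finType) (g : T -> R) (M d : R) (t0 : T) :
  (forall t, g t <= M) -> M - d <= avg g -> M - #|T|%:R * d <= g t0.
Proof.
move=> gM; rewrite /avg.
have T0 : (0 < #|T|)%N by apply/card_gt0P; exists t0.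
rewrite mulrC ler_pdivlMr ?ltr0n// (bigD1 t0)//=.
have : \sum_(t | t != t0) g t <= (#|T|%:R - 1) * M.
  apply: (@le_trans _ _ (\sum_(t | t != t0) M)); first exact: ler_sum.
  rewrite sumr_const -[leLHS]mulr_natl.
  have -> : (#|T|%:R : R) = 1 + #|[pred t | t != t0]|%:R.
    by rewrite (cardD1 t0) inE natrD; congr (_ + _%:R); apply: eq_card => t; rewrite !inE andbT.
  by rewrite [1 + _]addrC addrK.
lra.
Qed.

Variable s : scalars.
Local Notation K := (scalar_field R s).

(** Signs can align all real parts or all imaginary parts; the larger of the two sums carries at
    least half of the total modulus. *)
Lemma sign_choice (n : nat) (a : 'I_n -> K) : exists e : {ffun 'I_n -> bool},
  \sum_i ab (a i) <= 2 * ab (\sum_i (-1) ^+ e i * a i).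
Proof.
have key (p : K -> R) : (forall r z, p (rl r * z) = r * p z) ->
    (forall F : 'I_n -> K, p (\sum_i F i) = \sum_i p (F i)) ->
    (forall z, `|p z| <= ab z) ->
    exists e : {ffun 'I_n -> bool},
      \sum_i `|p (a i)| <= ab (\sum_i (-1) ^+ e i * a i).
  move=> pZ psum ple; exists [ffun i => p (a i) < 0].
  apply: le_trans (ple _); rewrite psum; apply: le_trans (ler_norm _).
  apply: ler_sum => i _; rewrite ffunE -(@rl_sign R s) pZ.
  by rewrite -normrEsign.
have [e1 h1] := key _ (@re_rlM R s) (fun F => re_sum _ _ F) (@re_le_ab R s).
have [e2 h2] := key _ (@im_rlM R s) (fun F => im_sum _ _ F) (@im_le_ab R s).
have h : \sum_i ab (a i) <= \sum_i `|scalar_re (a i)| + \sum_i `|im (a i)|.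
  by rewrite -big_split; apply: ler_sum => i _; exact: ab_le_re_im.
have [le12|le21] := leP (\sum_i `|scalar_re (a i)|) (\sum_i `|im (a i)|).
  by exists e2; lra.
by exists e1; lra.
Qed.

(** A variance estimate: expanding the sum of the [ab (z i - rl u) ^+ 2] bounds it by
    [2 * n * k * u ^+ 2], hence also each term. *)
Lemma ab_near_mean (n : nat) (z : 'I_n -> K) (u k : R) : 0 <= u ->
  \sum_i ab (z i) ^+ 2 <= n%:R * u ^+ 2 ->
  n%:R * u * (1 - k) <= \sum_i scalar_re (z i) ->
  forall i, ab (z i - rl u) ^+ 2 <= 2 * n%:R * k * u ^+ 2.
Proof.
move=> u0 hQ hS i.
have : ab (z i - rl u) ^+ 2 <= \sum_i ab (z i - rl u) ^+ 2.
  by rewrite (bigD1 i)//= lerDl sumr_ge0// => j _; exact: sqr_ge0.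
have -> : \sum_i ab (z i - rl u) ^+ 2 =
    \sum_i ab (z i) ^+ 2 - 2 * u * (\sum_i scalar_re (z i)) + n%:R * u ^+ 2.
  have <- : \sum_(j < n) u ^+ 2 = n%:R * u ^+ 2.
    by rewrite sumr_const card_ord mulr_natl.
  by rewrite mulr_sumr -sumrB -big_split; apply: eq_bigr => j _; rewrite ab_subr_sqr.
have := ler_wpM2l u0 hS; lra.
Qed.

End Auxiliary.

Section EllOne.
Variables (R : realType) (s : scalars) (Y : banachType R s).
Local Notation K := (scalar_field R s).

Lemma rnorm_rsum_le (I : finType) (x : I -> Y) e :
  rnorm (rsum x e) <= \sum_i rnorm (x i).
Proof.
apply: le_trans (rnorm_sum _ _ _) _; apply: ler_sum => i _.
by rewrite rnorm_signZ.
Qed.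

(** Every sign sum has norm almost [n * u], where [u] is the quadratic mean of the norms. A
    functional norming the sum with signs [e] therefore takes a value close to [u] at each signed
    vector. Given coefficients [a], the signs are those of [sign_choice], and this functional bounds
    the combination from below. *)
Lemma ell1_of_extremal (n : nat) (x : 'I_n -> Y) (L : R) : (0 < n)%N ->
  L = 1 - (200 * n%:R * 2 ^+ n)^-1 ->
  L * n%:R * \sum_i rnorm (x i) ^+ 2 < rad2 x ->
  exists y : 'I_n -> Y, (forall i, rnorm (y i) <= 1) /\
    forall a : 'I_n -> K,
      \sum_i ab (a i) <= 3 * rnorm (\sum_i a i *: y i).
Proof.
move=> n0 LE; set Q := \sum_i rnorm (x i) ^+ 2 => hx.
have nR : 0 < (n%:R : R) by rewrite ltr0n.
have SeQ e : rnorm (rsum x e) ^+ 2 <= n%:R * Q.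
  rewrite -[X in X%:R](card_ord n); apply: le_trans (sqr_sum_le_card _).
  rewrite ler_pXn2r ?nnegrE ?rnorm_ge0 ?rnorm_rsum_le//.
  by apply: sumr_ge0 => i _; exact: rnorm_ge0.
have Qge0 : 0 <= Q by apply: sumr_ge0 => i _; exact: sqr_ge0.
have Q0 : 0 < Q.
  rewrite lt0r Qge0 andbT; apply/eqP => Q0; move: hx; rewrite Q0 mulr0.
  apply/negP; rewrite -leNgt -(@avg_const R {ffun 'I_n -> bool} 0) ?card_signs_gt0//.
  by apply: avg_le => e; apply: le_trans (SeQ e) _; rewrite Q0 mulr0.
(* Chosen so that [2 * n * k * u ^+ 2] in [ab_near_mean] is [(u / 10) ^+ 2]; the factor [2 ^+ n] in
   [L] is consumed by [avg_extremal]. *)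
pose k : R := (200 * n%:R)^-1.
have k0 : 0 < k by rewrite invr_gt0 mulr_gt0.
have nk : n%:R * k = 200^-1 by rewrite /k; field; lra.
have SeL e : n%:R * Q * (1 - k) <= rnorm (rsum x e) ^+ 2.
  have := @avg_extremal R _ (fun e => rnorm (rsum x e) ^+ 2) (n%:R * Q)
    (n%:R * Q * (200 * n%:R * 2 ^+ n)^-1) e SeQ.
  rewrite card_ffun card_bool card_ord natrX.
  have -> : n%:R * Q - 2%:R ^+ n * (n%:R * Q / (200 * n%:R * 2 ^+ n)) =
      n%:R * Q * (1 - k).
    by rewrite /k; field; rewrite (gt_eqF nR)/= expf_neq0.
  apply; apply: le_trans (ltW hx).
  by rewrite LE mulrBl mulrBl mul1r; lra.
pose u : R := Num.sqrt (Q / n%:R).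
have u2 : u ^+ 2 = Q / n%:R by rewrite sqr_sqrtr// divr_ge0.
have u0 : 0 < u by rewrite sqrtr_gt0 divr_gt0.
have QE : Q = n%:R * u ^+ 2 by rewrite u2 mulrC divfK ?gt_eqF.
have k1 : k <= 1.
  have n1 : 1 <= (n%:R : R) by rewrite ler1n.
  have := ler_wpM2r (ltW k0) n1; rewrite nk; lra.
have Slow e : n%:R * u * (1 - k) <= rnorm (rsum x e).
  have c0 : 0 <= n%:R * u * (1 - k) by rewrite !mulr_ge0 ?subr_ge0// ltW.
  rewrite -(@ler_pXn2r _ 2)// ?nnegrE ?rnorm_ge0//.
  apply: le_trans (SeL e); rewrite QE.
  have -> : (n%:R * u * (1 - k)) ^+ 2 = n%:R * (n%:R * u ^+ 2) * (1 - k) * (1 - k).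
    by ring.
  rewrite ler_piMr//; last by rewrite lerBlDr lerDl ltW.
  by rewrite -QE mulr_ge0 ?subr_ge0// mulr_ge0// ltW.
have near (z : 'I_n -> K) : (forall i, ab (z i) <= rnorm (x i)) ->
    n%:R * u * (1 - k) <= \sum_i scalar_re (z i) ->
    forall i, ab (z i - rl u) <= u / 10.
  move=> zx hz i.
  rewrite -(@ler_pXn2r _ 2)// ?nnegrE ?ab_ge0 ?divr_ge0 ?(ltW u0)//.
  apply: le_trans (ab_near_mean (ltW u0) _ hz i) _; last first.
    by rewrite -[2 * n%:R * k]mulrA nk; lra.
  rewrite -QE; apply: ler_sum => j _.
  by rewrite ler_pXn2r ?nnegrE ?ab_ge0 ?rnorm_ge0.
(* The norms themselves, taken as scalars, satisfy the hypotheses of [near]. *)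
have xu i : rnorm (x i) <= 11 / 10 * u.
  have h : ab (rl (rnorm (x i)) - rl u : K) <= u / 10.
    apply: (near (fun i => rl (rnorm (x i)))).
      by move=> j; rewrite ab_rl ger0_norm ?rnorm_ge0.
    apply: le_trans (Slow [ffun=> false]) _.
    apply: le_trans (rnorm_rsum_le _ _) _.
    by apply: ler_sum => j _; rewrite re_rl.
  move: h; rewrite -rlN -rlD ab_rl => h.
  have := ler_norm (rnorm (x i) - u); lra.
pose c : R := (11 / 10 * u)^-1.
have c0 : 0 < c by rewrite invr_gt0 mulr_gt0//; lra.
exists (fun i => (rl c : K) *: x i); split.
  move=> i; rewrite rnorm_rlZ gtr0_norm// /c mulrC ler_pdivrMr ?mul1r//.
  by rewrite mulr_gt0//; lra.
move=> a; have [e he] := sign_choice a.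
have [g gE] := norming_functional (rsum x e).
pose z i := g ((-1) ^+ e i *: x i).
have zn : forall i, ab (z i - rl u) <= u / 10.
  apply: near.
    by move=> i; apply: le_trans (fval_le _ _) _; rewrite rnorm_signZ.
  by rewrite -re_sum /z -fval_sum -/(rsum x e) gE re_rl.
have -> : \sum_i a i *: (rl c *: x i) = (rl c : K) *: \sum_i a i *: x i.
  rewrite scaler_sumr; apply: eq_bigr => i _.
  by rewrite !scalerA mulrC.
rewrite rnorm_rlZ gtr0_norm//.
pose b i := (-1) ^+ e i * a i.
have gx : g (\sum_i a i *: x i) = rl u * (\sum_i b i) + \sum_i b i * (z i - rl u).
  rewrite fval_sum mulr_sumr -big_split; apply: eq_bigr => i _ /=.
  rewrite mulrBr [rl u * _]mulrC addrC subrK /b /z !fvalZ.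
  by rewrite mulrACA -signr_addb addbb mul1r.
have hb : ab (\sum_i b i * (z i - rl u)) <= u / 10 * \sum_i ab (a i).
  apply: le_trans (ab_sum _ _ _) _; rewrite mulr_sumr; apply: ler_sum => i _.
  by rewrite abM /b abM ab_sign mul1r mulrC ler_wpM2r ?ab_ge0.
have h1 := fval_le g (\sum_i a i *: x i).
have h2 : u * ab (\sum_i b i) - ab (\sum_i b i * (z i - rl u)) <=
    ab (g (\sum_i a i *: x i)).
  rewrite gx lerBlDr -[X in X * _]gtr0_norm// -(@ab_rl R s u) -abM.
  rewrite -{1}[rl u * _](addrK (\sum_i b i * (z i - rl u))).
  by apply: le_trans (abD _ _) _; rewrite abN.
have S0 : 0 <= \sum_i ab (a i) by apply: sumr_ge0 => i _; exact: ab_ge0.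
have cu : c * u = 10 / 11 by rewrite /c; field; lra.
have h3 : u * (\sum_i ab (a i)) <= u * (2 * ab (\sum_i b i)).
  by rewrite ler_wpM2l// ltW.
(* 4/10 is 1/2 from the signs minus 1/10 from [near]; normalizing by [11 / 10 * u] leaves 4/11, more
   than 1/3. *)
have h4 : 4 / 10 * u * (\sum_i ab (a i)) <= rnorm (\sum_i a i *: x i) by lra.
have := ler_wpM2l (ltW c0) h4.
have -> : c * (4 / 10 * u * \sum_i ab (a i)) = 4 / 11 * \sum_i ab (a i).
  have -> : c * (4 / 10 * u * \sum_i ab (a i)) = 4 / 10 * (c * u) * \sum_i ab (a i) by ring.
  by rewrite cu; lra.
lra.
Qed.

Lemma ell1_sequence (n : nat) : no_nontrivial_type Y ->
  exists y : nat -> Y, (forall i, rnorm (y i) <= 1) /\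
    forall a : nat -> K,
      \sum_(i < n) ab (a i) <= 3 * rnorm (\sum_(i < n) a i *: y i).
Proof.
move=> hY.
(* [has_type_of_bound] asks for at least two vectors; the two surplus ones get coefficient zero at
   the end. *)
pose L : R := 1 - (200 * n.+2%:R * 2 ^+ n.+2)^-1.
have [x hx] : exists x : 'I_n.+2 -> Y,
    L * n.+2%:R * \sum_i rnorm (x i) ^+ 2 < rad2 x.
  apply: contrapT => nx.
  have L1 : L < 1 by rewrite /L ltrBlDr ltrDl invr_gt0 mulr_gt0 ?exprn_gt0 ?mulr_gt0 ?ltr0n.
  have [//|p p1 hp] := @has_type_of_bound R s Y n.+2 L isT L1.
    apply: (@type_bound_finType _ _ _ _ _ 'I_n.+2); first by rewrite card_ord.
    by move=> x; rewrite leNgt; apply/negP => hx; apply: nx; exists x.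
  exact: hY p1 hp.
have [//|y [y1 ya]] := ell1_of_extremal _ erefl hx.
exists (fun i => y (inord i)); split=> // a.
pose f : 'I_n -> 'I_n.+2 := widen_ord (leq_trans (leqnSn n) (leqnSn n.+1)).
have fI : injective f by move=> i j /(congr1 val) /= /val_inj.
have := ya (zero_ext 0 f (fun i : 'I_n => a i)).
rewrite !(sum_codom fI); try by move=> i ni; rewrite zero_ext_out ?ab0 ?scale0r.
under eq_bigr do rewrite zero_extE//.
under [X in _ <= 3 * rnorm X -> _]eq_bigr do rewrite zero_extE//.
under [X in _ -> _ <= 3 * rnorm X]eq_bigr => i _.
  have -> : inord i = f i by apply: val_inj; rewrite /= inordK// (leq_trans (ltn_ord i))// ltnW.
  over.
by [].
Qed.

End EllOne.

(** * Copies of l_infty^n in spaces without cotype *)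

(** Each index is coloured by the cells of width [eta] that contain its values, and [N] is [n] times
    the number of colours. [N] must not depend on [h]: the vectors and functionals that define [h]
    are only available once [N] is fixed. *)
Lemma pigeonhole_close (R : realType) (C : finType) (n : nat) (B eta : R) :
  0 < eta -> exists N : nat, forall h : C -> 'I_N -> R,
    (forall k j, `|h k j| <= B) ->
    exists2 f : 'I_n -> 'I_N, injective f &
      forall k i j, `|h k (f i) - h k (f j)| <= eta.
Proof.
move=> eta0; pose Q := (Num.truncn (2 * B / eta)).+1.
pose D : finType := {ffun C -> 'I_Q}.
exists (n * #|D|)%N => h hB; set N := (n * #|D|)%N in h hB *.
pose col (j : 'I_N) : D := [ffun k => inord (Num.truncn ((h k j + B) / eta))].
have [c hc] : exists c, (n <= #|[set j | col j == c]%SET|)%N.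
  apply: contrapT => nc.
  have {}nc c : (#|[set j | col j == c]%SET| < n)%N.
    by rewrite ltnNge; apply/negP => hc; apply: nc; exists c.
  have n0 : (0 < n)%N by apply: leq_ltn_trans (nc [ffun=> ord0]).
  have D0 : (0 < #|D|)%N by apply/card_gt0P; exists [ffun=> ord0].
  have : (N <= #|D| * n.-1)%N.
    rewrite -{1}(card_ord N) -sum1_card (partition_big col xpredT)//=.
    rewrite -sum_nat_const; apply: leq_sum => c _; rewrite sum1dep_card.
    by rewrite -ltnS prednK.
  by rewrite /N mulnC leq_pmul2l// -ltnS prednK// ltnn.
have [|f fI] := @exists_injection {j | j \in [set j | col j == c]%SET} 'I_n.
  by rewrite card_sig card_ord.
exists (val \o f) => [|k i j /=]; first by apply: inj_comp => //; exact: val_inj.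
have colE i' : col (val (f i')) = c by have := valP (f i'); rewrite inE => /eqP.
have : col (val (f i)) k = col (val (f j)) k by rewrite !colE.
rewrite !ffunE => /(congr1 (@nat_of_ord Q)).
have bnd j' : 0 <= (h k j' + B) / eta <= 2 * B / eta.
  have := hB k j'; rewrite ler_norml => /andP[h1 h2].
  by rewrite divr_ge0 ?ler_pM2r ?invr_gt0 ?(ltW eta0)//=; lra.
have ltQ j' : (Num.truncn ((h k j' + B) / eta) < Q)%N.
  rewrite ltnS; apply: le_truncn; by have /andP[] := bnd j'.
rewrite !inordK// => e.
have tr j' := @truncn_itv R ((h k j' + B) / eta) (proj1 (andP (bnd j'))).
have /andP[l1 u1] := tr (val (f i)); have /andP[l2 u2] := tr (val (f j)).
rewrite -e in l2 u2.
move: l1 u1 l2 u2; rewrite !ler_pdivlMr// !ltr_pdivrMr// -natr1.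
set T : R := (Num.truncn _)%:R => l1 u1 l2 u2.
by rewrite ler_norml; apply/andP; split; lra.
Qed.

Section EllInfty.
Variables (R : realType) (s : scalars) (X : banachType R s).
Local Notation K := (scalar_field R s).

(** No norm exceeds [B], the root of [rad2 x], so a nearly maximal sum of squares makes every norm
    nearly [B]. The norms of the sign sums have mean square [B ^+ 2] and mean almost [B], hence a
    small variance; the factor [2 ^+ N] in [L] makes it small enough to control each single choice
    of signs. *)
Lemma linf_of_extremal (N : nat) (x : 'I_N -> X) (d : R) (L : R) :
  (0 < N)%N -> 0 < d <= 1 -> L = 1 - d ^+ 2 / (32 * N%:R * 2 ^+ N) ->
  L * N%:R * rad2 x < \sum_i rnorm (x i) ^+ 2 ->
  exists u : 'I_N -> X, (forall i, 1 <= rnorm (u i)) /\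
    forall e, rnorm (rsum u e) <= 1 + d.
Proof.
move=> N0 /andP[d0 d1] LE hx.
have NR : 0 < (N%:R : R) by rewrite ltr0n.
pose P2 : R := 2 ^+ N.
have P20 : 1 <= P2 by rewrite exprn_ege1//; lra.
pose k : R := d ^+ 2 / (32 * P2).
have k0 : 0 < k by rewrite divr_gt0 ?exprn_gt0//; lra.
have kE : P2 * k = d ^+ 2 / 32 by rewrite /k; field; lra.
have kd : k <= d / 8.
  have h : 1 * k <= P2 * k by rewrite ler_wpM2r// ltW.
  have dd : d * d <= d * 1 by rewrite ler_wpM2l// ltW.
  by move: h; rewrite mul1r kE expr2; lra.
pose B := Num.sqrt (rad2 x).
have B0 : 0 <= B by exact: sqrtr_ge0.
have BE : B ^+ 2 = rad2 x by rewrite sqr_sqrtr// rad2_ge0.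
have rB i : rnorm (x i) <= B.
  by rewrite -(@ler_pXn2r _ 2)// ?nnegrE ?rnorm_ge0// BE rnorm_le_rad2.
have Nk : L * N%:R = N%:R - k.
  rewrite LE /k /P2; field; rewrite gt_eqF//= gt_eqF//; exact: lt_le_trans P20.
have lowsq i : B ^+ 2 * (1 - k) < rnorm (x i) ^+ 2.
  have : \sum_(j | j != i) rnorm (x j) ^+ 2 <= (N%:R - 1) * B ^+ 2.
    apply: (@le_trans _ _ (\sum_(j | j != i) B ^+ 2)).
      by apply: ler_sum => j _; rewrite ler_pXn2r ?nnegrE ?rnorm_ge0.
    rewrite sumr_const -[leLHS]mulr_natl.
    have -> : (N%:R : R) = 1 + #|[pred t | t != i]|%:R.
      by rewrite -{1}(card_ord N) (cardD1 i) inE natrD; congr (_ + _%:R);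
        apply: eq_card => t; rewrite !inE andbT.
    by rewrite [1 + _]addrC addrK.
  move: hx; rewrite (bigD1 i)//= Nk -BE; lra.
have Bpos : 0 < B.
  rewrite lt0r B0 andbT; apply/eqP => B00; have := lowsq (Ordinal N0).
  have := rB (Ordinal N0); rewrite B00 expr0n mul0r => h.
  have -> : rnorm (x (Ordinal N0)) = 0.
    by apply/eqP; rewrite eq_le h rnorm_ge0.
  by rewrite expr0n ltxx.
have low i : B * (1 - k) <= rnorm (x i).
  rewrite leNgt; apply/negP => hlt; have := lowsq i; apply/negP; rewrite -leNgt.
  have k1 : 0 <= 1 - k by lra.
  have c0 : 0 <= B * (1 - k) by rewrite mulr_ge0.
  apply: (@le_trans _ _ ((B * (1 - k)) ^+ 2)).
    by rewrite ler_pXn2r ?nnegrE ?rnorm_ge0// ltW.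
  rewrite exprMn ler_wpM2l ?sqr_ge0// expr2 ler_piMl//; lra.
(* Flipping all signs except the one at [i] and adding leaves twice the term at [i]. *)
have avg_low i : rnorm (x i) <= avg (fun e => rnorm (rsum x e)).
  pose d' : {ffun 'I_N -> bool} := [ffun j => j != i].
  suff : 2 * rnorm (x i) <= avg (fun e => rnorm (rsum x e) +
      rnorm (rsum x (signs_add e d'))).
    rewrite avgD.
    have -> := avg_bij (fun e => rnorm (rsum x e)) (@signs_add_inj _ d').
    lra.
  rewrite -[leLHS](@avg_const _ {ffun 'I_N -> bool}) ?card_signs_gt0//.
  apply: avg_le => e; apply: le_trans (rnormD _ _).
  rewrite /rsum -big_split /= (bigD1 i)//= big1 ?addr0; last first.
    move=> j ji; rewrite !ffunE ji addbT -scalerDl signrN subrr.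
    by rewrite scale0r.
  rewrite !ffunE eqxx addbF -scalerDl -[(-1) ^+ e i]mul1r -mulrDl rnormZ abM.
  by rewrite ab_sign mulr1 -(@rl1 R s) -rlD ab_rl ger0_norm.
pose c : R := (B * (1 - k))^-1.
have c0 : 0 < c by rewrite invr_gt0 mulr_gt0//; lra.
have cB : c * (B * (1 - k)) = 1 by rewrite /c mulVf// gt_eqF// -invr_gt0.
exists (fun i => (rl c : K) *: x i); split.
  by move=> i; rewrite rnorm_rlZ gtr0_norm// -cB ler_pM2l.
move=> e.
have -> : rsum (fun i => (rl c : K) *: x i) e = (rl c : K) *: rsum x e.
  by rewrite /rsum scaler_sumr; apply: eq_bigr => i _; rewrite !scalerA mulrC.
rewrite rnorm_rlZ gtr0_norm//.
(* One squared deviation is at most their sum, which is [P2] times the variance. *)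
have hs : (rnorm (rsum x e) - B) ^+ 2 <= (B * (d / 4)) ^+ 2.
  apply: (@le_trans _ _ (P2 * avg (fun e => (rnorm (rsum x e) - B) ^+ 2))).
    rewrite /avg card_ffun card_bool card_ord natrX -/P2 mulrA divff ?mul1r; last lra.
    by rewrite (bigD1 e)//= lerDl sumr_ge0// => j _; exact: sqr_ge0.
  have -> : avg (fun e => (rnorm (rsum x e) - B) ^+ 2) =
      2 * B * (B - avg (fun e => rnorm (rsum x e))).
    transitivity (avg (fun e => rnorm (rsum x e) ^+ 2 +
        ((- 2 * B) * rnorm (rsum x e) + B ^+ 2))).
      by apply: eq_avg => e'; ring.
    rewrite !avgD avgZ avg_const ?card_signs_gt0// -/(rad2 x) -BE; ring.
  have i0 := Ordinal N0.
  have h : B - avg (fun e => rnorm (rsum x e)) <= B * k.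
    have := avg_low i0; have := low i0; lra.
  have PB : 0 <= P2 * (2 * B) by rewrite mulr_ge0//; lra.
  have := ler_wpM2l PB h.
  have -> : P2 * (2 * B) * (B * k) = 2 * B ^+ 2 * (P2 * k) by ring.
  by rewrite kE exprMn; lra.
have Bd : 0 <= B * (d / 4) by rewrite mulr_ge0//; lra.
have hS : rnorm (rsum x e) <= B * (1 + d / 4).
  rewrite -subr_le0 mulrDr mulr1 opprD addrA subr_le0 leNgt; apply/negP => hlt.
  have : (B * (d / 4)) ^+ 2 < (rnorm (rsum x e) - B) ^+ 2.
    by rewrite ltr_pXn2r ?nnegrE//; exact: le_trans Bd (ltW hlt).
  by rewrite ltNge hs.
apply: le_trans (ler_wpM2l (ltW c0) hS) _.
have h1 : 1 + d / 4 <= (1 + d) * (1 - k).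
  have dk : d * k <= d * (d / 8) by rewrite ler_wpM2l// ltW.
  have dd : d * d <= d * 1 by rewrite ler_wpM2l// ltW.
  lra.
have := ler_wpM2l (ltW (mulr_gt0 c0 Bpos)) h1.
have -> : c * B * ((1 + d) * (1 - k)) = (1 + d) * (c * (B * (1 - k))) by ring.
by rewrite cB mulr1 mulrA.
Qed.

Lemma linf_sequence (N : nat) (d : R) : no_nontrivial_cotype X -> 0 < d <= 1 ->
  exists u : 'I_N -> X, (forall i, 1 <= rnorm (u i)) /\
    forall e, rnorm (rsum u e) <= 1 + d.
Proof.
move=> hX d01; have /andP[d0 d1] := d01; have [->|N0] := posnP N.
  exists (fun=> 0); split; first by case.
  by move=> e; rewrite /rsum big_ord0 rnorm0 addr_ge0// ltW.
pose L : R := 1 - d ^+ 2 / (32 * N%:R * 2 ^+ N).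
have [x hx] : exists x : 'I_N -> X, L * N%:R * rad2 x < \sum_i rnorm (x i) ^+ 2.
  apply: contrapT => nx.
  have L1 : L < 1.
    by rewrite /L ltrBlDr ltrDl divr_gt0 ?exprn_gt0 ?mulr_gt0 ?exprn_gt0 ?ltr0n.
  have [|q hq] := @has_cotype_of_bound R s X N L N0 L1.
    apply: (@cotype_bound_finType _ _ _ _ _ 'I_N); first by rewrite card_ord.
    by move=> x; rewrite leNgt; apply/negP => hx; apply: nx; exists x.
  exact: hX hq.
exact: (linf_of_extremal N0 d01 erefl hx).
Qed.

End EllInfty.

(** * Almost biorthogonal blocks *)

Lemma sum_injection_le (R : realType) (I J : finType) (f : J -> I) (G : I -> R) :
  injective f -> (forall i, 0 <= G i) -> \sum_j G (f j) <= \sum_i G i.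
Proof.
move=> fI G0; pose H i := if i \in codom f then G i else 0.
have -> : \sum_j G (f j) = \sum_i H i.
  rewrite (sum_codom fI); first by apply: eq_bigr => j _; rewrite /H codom_f.
  by move=> i /negPf ni; rewrite /H ni.
by apply: ler_sum => i _; rewrite /H; case: ifP.
Qed.

Section BiorthogonalBlocks.
Variables (R : realType) (s : scalars) (X : banachType R s).
Local Notation K := (scalar_field R s).

Lemma half_diff_le (g h : functional X) x :
  ab (rl 2^-1 * (g x - h x)) <= rnorm x.
Proof.
rewrite abM ab_rl ger0_norm//.
have := abD (g x) (- h x); rewrite abN.
have := fval_le g x; have := fval_le h x; lra.
Qed.

Definition half_diff (g h : functional X) : functional X.
Proof.
apply: (@Functional R s X (fun x => rl 2^-1 * (g x - h x))).
- by move=> x y; rewrite !fvalD -mulrDr; congr (_ * _); ring.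
- by move=> a x; rewrite !fvalZ -mulrBr mulrCA.
- exact: half_diff_le.
Defined.

Section SignBounded.
Variables (N : nat) (u : 'I_N -> X) (C : R).
Hypothesis uC : forall e, rnorm (rsum u e) <= C.

Lemma sum_re_functional_le (g : functional X) :
  \sum_j `|scalar_re (g (u j))| <= C.
Proof.
pose e : {ffun 'I_N -> bool} := [ffun j => scalar_re (g (u j)) < 0].
apply: le_trans (uC e); apply: le_trans (fval_le g _).
apply: le_trans (re_le_ab _); apply: le_trans (ler_norm _).
rewrite /rsum fval_sum re_sum; apply: ler_sum => j _.
by rewrite fvalZ ffunE -(@rl_sign R s) re_rlM -normrEsign.
Qed.

Lemma sum_ab_functional_le (g : functional X) : \sum_j ab (g (u j)) <= 2 * C.
Proof.
have [e he] := sign_choice (fun j => g (u j)).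
apply: le_trans he _; rewrite ler_pM2l//; apply: le_trans (uC e).
apply: le_trans (fval_le g _); rewrite /rsum fval_sum le_eqVlt; apply/orP; left.
by apply/eqP; congr ab; apply: eq_bigr => j _; rewrite fvalZ.
Qed.

Lemma rnorm_term_le i : rnorm (u i) <= C.
Proof.
have [g gE] := norming_functional (u i).
rewrite -(@re_rl R s (rnorm _)) -gE; apply: le_trans (sum_re_functional_le g).
rewrite (bigD1 i)//=; apply: le_trans (ler_norm _) _.
by rewrite lerDl sumr_ge0.
Qed.

Lemma rnorm_two_terms_le i p (t : R) : i != p -> `|t| <= 1 ->
  rnorm (u i + (rl t : K) *: u p) <= C.
Proof.
move=> ip t1; have [g gE] := norming_functional (u i + (rl t : K) *: u p).
rewrite -(@re_rl R s (rnorm _)) -gE; apply: le_trans (sum_re_functional_le g).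
rewrite fvalD fvalZ reD re_rlM (bigD1 i)//= (bigD1 p)/=; last by rewrite eq_sym.
have := ler_norm (scalar_re (g (u i))).
have : t * scalar_re (g (u p)) <= `|scalar_re (g (u p))|.
  by apply: le_trans (ler_norm _) _; rewrite normrM ler_piMl.
have : 0 <= \sum_(j < N | (j != i) && (j != p)) `|scalar_re (g (u j))|.
  exact: sumr_ge0.
lra.
Qed.

(* Parallelogram law for the values of [g] at [u i + u p] and [u i - u p]. *)
Lemma norming_functional_off_diagonal (g : functional X) i p : i != p ->
  1 <= rnorm (u i) -> g (u i) = rl (rnorm (u i)) ->
  ab (g (u p)) ^+ 2 <= C ^+ 2 - 1.
Proof.
move=> ip u1 gE; have C0 : 0 <= C := le_trans (rnorm_ge0 _) (rnorm_term_le i).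
have sq x : rnorm x <= C -> ab (g x) ^+ 2 <= C ^+ 2.
  move=> xC; rewrite ler_pXn2r ?nnegrE ?ab_ge0//.
  exact: le_trans (fval_le g x) xC.
have h1 : ab (g (u i + u p)) ^+ 2 <= C ^+ 2.
  apply: sq; have := @rnorm_two_terms_le i p 1 ip.
  by rewrite rl1 scale1r normr1 => ->.
have h2 : ab (g (u i - u p)) ^+ 2 <= C ^+ 2.
  apply: sq; have := @rnorm_two_terms_le i p (-1) ip.
  by rewrite rlN rl1 scaleN1r normrN1 => ->.
have := parallelogram (g (u i)) (g (u p)).
rewrite -fvalD -fvalB gE ab_rl ger0_norm ?rnorm_ge0//.
have : 1 <= rnorm (u i) ^+ 2 by rewrite expr_ge1 ?rnorm_ge0.
lra.
Qed.

End SignBounded.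

(** [V] and [F] collect the vectors and functionals of earlier blocks. For a pair [P i], [Q i] on
    which all their pairings nearly agree, the difference of the vectors and half the difference of
    the norming functionals make these pairings cancel. The half keeps the functional in the unit
    ball, and the two diagonal values near 1 add up to a pairing near 1. *)
Lemma biorthogonal_block (I : finType) (V : I -> X) (F : I -> functional X)
    (n : nat) (eta : R) : no_nontrivial_cotype X -> 0 < eta ->
  exists (x : 'I_n -> X) (f : 'I_n -> functional X),
  [/\ forall a : 'I_n -> K, (forall i, ab (a i) <= 1) ->
        rnorm (\sum_i a i *: x i) <= 3,
      forall i l, ab (f i (x l) - (i == l)%:R) <= eta,
      forall i k, ab (F k (x i)) <= eta &
      forall i k, ab (f i (V k)) <= eta].
Proof.
move=> hX eta0.
(* The errors below are at most [d + t] on the diagonal and [2 * t] off it, both within [3 * t]. *)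
pose t : R := Num.min 1 eta / 3.
have m0 : 0 < Num.min 1 eta by rewrite lt_min ltr01.
have m1 : Num.min 1 eta <= 1 by rewrite ge_min lexx.
have me : Num.min 1 eta <= eta by rewrite ge_min lexx orbT.
have t0 : 0 < t by rewrite /t; lra.
have t1 : t <= 1 / 3 by rewrite /t; lra.
have te : 3 * t <= eta by rewrite /t; lra.
(* For sign sums bounded by [1 + d], the squared off-diagonal values are at most [(1 + d) ^+ 2 - 1],
   which is at most [3 * d = t ^+ 2]. *)
pose d := t ^+ 2 / 3.
have tt : t ^+ 2 <= t * (1 / 3) by rewrite expr2 ler_wpM2l// ltW.
have d0 : 0 < d by rewrite divr_gt0 ?exprn_gt0.
have dt : d <= t / 9 by rewrite /d; lra.
pose B : R := \sum_k rnorm (V k) + 2.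
have [N hN] := @pigeonhole_close R (I * (bool * bool))%type (n * 2) B (eta / 2)
  (divr_gt0 eta0 (ltr0Sn _ _)).
have [|u [u1 uC]] := @linf_sequence R s X N d hX; first by rewrite d0; lra.
have /choice[g gE] : forall j, exists g : functional X, g (u j) = rl (rnorm (u j)).
  by move=> j; exact: norming_functional.
pose z (k : I) (b : bool) (j : 'I_N) : K := if b then g j (V k) else F k (u j).
(* The first boolean selects pairings with earlier vectors or with earlier functionals, the second
   the real or imaginary part; each part is controlled within [eta / 2]. *)
pose h (k : I * (bool * bool)) (j : 'I_N) : R :=
  if k.2.2 then scalar_re (z k.1 k.2.1 j) else im (z k.1 k.2.1 j).
have VB k : rnorm (V k) <= B.
  rewrite /B (bigD1 k)//= -addrA lerDl addr_ge0 ?sumr_ge0// => j _.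
  exact: rnorm_ge0.
have uB j : rnorm (u j) <= B.
  apply: le_trans (rnorm_term_le uC j) _; rewrite /B.
  have : 0 <= \sum_k rnorm (V k) by apply: sumr_ge0 => k _; exact: rnorm_ge0.
  lra.
have zB k b j : ab (z k b j) <= B.
  by rewrite /z; case: b; apply: le_trans (fval_le _ _) _.
have [|sg0 sg0I sg0P] := hN h.
  move=> [k [b c]] j; rewrite /h /=; apply: le_trans (zB k b j).
  by case: c; [exact: re_le_ab|exact: im_le_ab].
have [|e eI] := @exists_injection 'I_(n * 2) ('I_n * bool)%type.
  by rewrite card_prod card_bool !card_ord.
pose sg := sg0 \o e.
have sgI : injective sg by apply: inj_comp.
have zclose k b p q : ab (z k b (sg p) - z k b (sg q)) <= eta.
  apply: le_trans (ab_le_re_im _) _.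
  have h1 := sg0P (k, (b, true)) (e p) (e q).
  have h2 := sg0P (k, (b, false)) (e p) (e q).
  move: h1 h2; rewrite /h /= reD reN.
  have -> : im (z k b (sg p) - z k b (sg q)) = im (z k b (sg p)) - im (z k b (sg q)).
    by rewrite -mulN1r imD -(@rl1 R s) -rlN im_rlM; ring.
  rewrite /sg /=; lra.
have cross p q : p != q -> ab (g (sg p) (u (sg q))) <= t.
  move=> pq; rewrite -(@ler_pXn2r _ 2)// ?nnegrE ?ab_ge0 ?(ltW t0)//.
  have npq : sg p != sg q by rewrite (inj_eq sgI).
  apply: le_trans (norming_functional_off_diagonal uC npq (u1 _) (gE _)) _.
  have dd : d * d <= d * 1 by rewrite ler_wpM2l ?(ltW d0)//; lra.
  have -> : t ^+ 2 = 3 * d by rewrite /d; field.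
  rewrite expr2; lra.
pose P i : 'I_N := sg (i, true).
pose Q i : 'I_N := sg (i, false).
exists (fun i => u (P i) - u (Q i)), (fun i => half_diff (g (P i)) (g (Q i))).
split.
- move=> a a1.
  (* All coefficients on the [u j] have modulus at most 1, so [sum_ab_functional_le] gives
     [2 * (1 + d)], at most 3. *)
  have [gg ggE] := norming_functional (\sum_i a i *: (u (P i) - u (Q i))).
  have -> : rnorm (\sum_i a i *: (u (P i) - u (Q i))) =
      ab (gg (\sum_i a i *: (u (P i) - u (Q i)))).
    by rewrite ggE ab_rl ger0_norm ?rnorm_ge0.
  rewrite fval_sum; apply: le_trans (ab_sum _ _ _) _.
  apply: (@le_trans _ _ (\sum_j ab (gg (u j)))); last first.
    by apply: le_trans (sum_ab_functional_le uC gg) _; lra.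
  apply: le_trans (sum_injection_le sgI (fun j => ab_ge0 (gg (u j)))).
  have -> : \sum_j ab (gg (u (sg j))) =
      \sum_i \sum_b ab (gg (u (sg (i, b)))).
    by rewrite pair_bigA; apply: eq_bigr => -[].
  apply: ler_sum => i _; rewrite big_bool /=.
  rewrite fvalZ fvalB abM; apply: le_trans (_ : 1 * _ <= _).
    by apply: ler_wpM2r; [exact: ab_ge0|exact: a1].
  by rewrite mul1r; apply: le_trans (abD _ _) _; rewrite abN.
- move=> i l /=; rewrite !fvalB.
  have [->|il] := eqVneq i l.
    set a := g (P l) (u (P l)); set b := g (P l) (u (Q l)).
    set a' := g (Q l) (u (P l)); set b' := g (Q l) (u (Q l)).
    have -> : rl 2^-1 * (a - b - (a' - b')) - 1%:R =
        rl 2^-1 * ((a - 1) + (b' - 1)) - rl 2^-1 * (b + a') :> K.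
      have e2 : rl 2^-1 * 2 = 1 :> K.
        by rewrite -(@rl_nat R s 2) -rlM mulVf ?rl1.
      transitivity (rl 2^-1 * (a - b - (a' - b')) - rl 2^-1 * 2 : K).
        by rewrite e2.
      ring.
    have near1 j : ab (g j (u j) - 1) <= d.
      rewrite gE -(@rl1 R s) -rlN -rlD ab_rl ger0_norm ?subr_ge0//.
      by rewrite lerBlDl rnorm_term_le.
    have ha : ab (a - 1) <= d by exact: near1.
    have hb : ab (b' - 1) <= d by exact: near1.
    have hc : ab b <= t by apply: cross; rewrite xpair_eqE andbF.
    have hc' : ab a' <= t by apply: cross; rewrite xpair_eqE andbF.
    apply: le_trans (abD _ _) _; rewrite abN !abM ab_rl ger0_norm//.
    have := abD (a - 1) (b' - 1); have := abD b a'; lra.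
  rewrite subr0 abM ab_rl ger0_norm//.
  have c1 b b' : ab (g (sg (i, b)) (u (sg (l, b')))) <= t.
    by apply: cross; rewrite xpair_eqE negb_and il.
  have := c1 true true; have := c1 true false.
  have := c1 false true; have := c1 false false; rewrite -/(P _) -/(Q _).
  set a := g (P i) (u (P l)); set b := g (P i) (u (Q l)).
  set a' := g (Q i) (u (P l)); set b' := g (Q i) (u (Q l)).
  have := abD (a - b) (- (a' - b')); rewrite abN.
  have := abD a (- b); have := abD a' (- b'); rewrite !abN; lra.
- move=> i k; rewrite fvalB; exact: (zclose k false (i, true) (i, false)).
- move=> i k /=; rewrite abM ab_rl ger0_norm//.
  have := zclose k true (i, true) (i, false).
  rewrite /z -/(P i) -/(Q i); have := ab_ge0 (g (P i) (V k) - g (Q i) (V k)); lra.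
Qed.

End BiorthogonalBlocks.

(** * Sections of the unit ball of l_infty^n *)

Section UnimodularVectors.
Variables (R : realType) (s : scalars).
Local Notation K := (scalar_field R s).

(** The squared modulus of [a + rl u * b] is a quadratic in [u], and [t] is the positive root of its
    difference with 1. Up to [t] the point is a convex combination of two points of the disc. *)
Lemma push_to_circle (a b : K) : ab a < 1 -> b != 0 ->
  exists2 t : R, 0 < t & ab (a + rl t * b) = 1 /\
    forall u, 0 <= u <= t -> ab (a + rl u * b) <= 1.
Proof.
move=> a1 b0.
pose C := scalar_re a * scalar_re b + im a * im b.
pose D := ab b ^+ 2; pose A := ab a ^+ 2.
have Ab0 : 0 < ab b.
  by rewrite lt0r ab_ge0 andbT; apply: contra_neq b0; exact: ab_eq0.
have D0 : 0 < D by rewrite exprn_gt0.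
have A1 : A < 1 by rewrite expr_lt1 ?ab_ge0.
have q u : ab (a + rl u * b) ^+ 2 = A + 2 * u * C + u ^+ 2 * D.
  by rewrite /A /C /D !ab_sqr reD imD re_rlM im_rlM; ring.
pose S := Num.sqrt (C ^+ 2 + D * (1 - A)).
have S2 : S ^+ 2 = C ^+ 2 + D * (1 - A).
  by rewrite sqr_sqrtr// addr_ge0 ?sqr_ge0// mulr_ge0 ?subr_ge0 ?(ltW D0) ?ltW.
have CS : C < S.
  apply: le_lt_trans (ler_norm _) _; rewrite -sqrtr_sqr ltr_sqrt.
    by rewrite ltrDl mulr_gt0// subr_gt0.
  by rewrite ltr_wpDl ?sqr_ge0// mulr_gt0// subr_gt0.
pose t := (S - C) / D.
have t0 : 0 < t by rewrite divr_gt0// subr_gt0.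
have t1 : ab (a + rl t * b) = 1.
  apply/eqP; rewrite -(@eqrXn2 _ 2)// ?ab_ge0// expr1n q; apply/eqP.
  have tD : t * D = S - C by rewrite /t divfK// gt_eqF.
  have -> : A + 2 * t * C + t ^+ 2 * D = A + 2 * t * C + t * (t * D) by ring.
  rewrite tD; apply: (mulIf (lt0r_neq0 D0)).
  have -> : (A + 2 * t * C + t * (S - C)) * D =
      A * D + 2 * C * (t * D) + (t * D) * (S - C) by ring.
  rewrite tD; have -> : A * D + 2 * C * (S - C) + (S - C) * (S - C) =
     A * D + S ^+ 2 - C ^+ 2 by ring.
  by rewrite S2; ring.
exists t => //; split=> // u /andP[u0 ut].
pose l := u / t.
have l0 : 0 <= l by rewrite divr_ge0// ltW.
have l1 : l <= 1 by rewrite ler_pdivrMr// mul1r.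
have -> : a + rl u * b = rl (1 - l) * a + rl l * (a + rl t * b).
  have -> : rl u = rl l * rl t :> K by rewrite -rlM divfK// gt_eqF.
  by rewrite rlD rlN rl1; ring.
apply: le_trans (abD _ _) _; rewrite !abM t1 !ab_rl !ger0_norm ?subr_ge0//.
have : (1 - l) * ab a <= (1 - l) * 1 by rewrite ler_wpM2l ?subr_ge0// ltW.
lra.
Qed.

Lemma exists_kernel_vector (p k : nat) (M : 'M[K]_(p, k)) : (k < p)%N ->
  exists2 v : 'rV[K]_p, v != 0 & v *m M = 0.
Proof.
move=> kp; have : kermx M != 0.
  rewrite kermx_eq0 /row_free; apply/eqP => e.
  by have := rank_leq_col M; rewrite e leqNgt kp.
by case/rowV0Pn => v /sub_kermxP vM v0; exists v.
Qed.

Variable X : banachType R s.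

Lemma closed_subspaceD (E : closed_subspace X) x y :
  cs_set E x -> cs_set E y -> cs_set E (x + y).
Proof.
move=> Ex Ey; have [_ h] := cs_submod E.
by have := h 1 x y; rewrite scale1r !inE => /(_ Ex Ey).
Qed.

Lemma closed_subspace0 (E : closed_subspace X) : cs_set E 0.
Proof. by have [h _] := cs_submod E; move: h; rewrite inE. Qed.

Lemma closed_subspaceZ (E : closed_subspace X) (a : K) x : cs_set E x -> cs_set E (a *: x).
Proof.
move=> Ex; have [_ h] := cs_submod E; have E0 := closed_subspace0 E.
by have := h a x 0; rewrite addr0 !inE => /(_ Ex E0).
Qed.

Lemma closed_subspace_sum (E : closed_subspace X) (I : finType) (F : I -> X) :
  (forall i, cs_set E (F i)) -> cs_set E (\sum_i F i).
Proof.
move=> EF; apply: big_ind => //; first exact: closed_subspace0.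
by move=> x y; exact: closed_subspaceD.
Qed.

Lemma codim_dependent (E : closed_subspace X) (k p : nat) (y : 'I_k -> X)
    (x : 'I_p -> X) : (k < p)%N ->
  (forall z, exists c : 'I_k -> K, cs_set E (z - \sum_(l < k) c l *: y l)) ->
  exists2 v : 'I_p -> K, exists i, v i != 0 & cs_set E (\sum_i v i *: x i).
Proof.
move=> kp hE; have /choice[c cE] := fun i => hE (x i).
have [v v0 vM] := exists_kernel_vector (\matrix_(i < p, l < k) c i l) kp.
exists (fun i => v 0 i).
  have [i vi] : exists i, v 0 i != 0.
    apply: contrapT => nv; move/eqP: v0; apply; apply/rowP => i.
    rewrite mxE; apply/eqP; rewrite -[_ == _]negbK; apply/negP => vi.
    by apply: nv; exists i.
  by exists i.
have -> : \sum_i v 0 i *: x i =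
    \sum_i v 0 i *: (x i - \sum_(l < k) c i l *: y l).
  under [RHS]eq_bigr do rewrite scalerBr scaler_sumr.
  rewrite sumrB -[LHS]subr0; congr (_ - _).
  rewrite exchange_big /= big1// => l _.
  under eq_bigr do rewrite scalerA.
  rewrite -scaler_suml.
  have := congr1 (fun N : 'rV_k => N 0 l) vM; rewrite !mxE.
  by under eq_bigr do rewrite mxE; move=> ->; rewrite scale0r.
apply: closed_subspace_sum => i; exact: closed_subspaceZ.
Qed.

(* Extreme points of the unit ball of a subspace of codimension [k] of
   [l_infty^n] have at least [n - k] unimodular coordinates. *)
Lemma exists_unimodular (E : closed_subspace X) (m n : nat) (x : 'I_n -> X) :
  codim_lt m E -> exists a : 'I_n -> K,
  [/\ forall i, ab (a i) <= 1, cs_set E (\sum_i a i *: x i) &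
      (n < m + #|[set i | (ab (a i) == 1)%R]%SET|)%N].
Proof.
move=> [k km [y hy]].
pose good (a : 'I_n -> K) := (forall i, ab (a i) <= 1) /\ cs_set E (\sum_i a i *: x i).
pose cnt (a : 'I_n -> K) := #|[set i | ab (a i) == 1]%SET|.
pose P (c : nat) := `[< exists2 a, good a & (c <= cnt a)%N >].
have P0 : exists c, P c.
  exists 0%N; apply/asboolP; exists (fun=> 0) => //; split.
    by move=> i; rewrite ab0.
  by rewrite big1 => [|i _]; [exact: closed_subspace0|rewrite scale0r].
have Pn c : P c -> (c <= n)%N.
  move=> /asboolP[a _ ca]; apply: leq_trans ca _.
  by apply: leq_trans (max_card _) _; rewrite card_ord.
(* A point with the most unimodular coordinates stands in for an extreme point. If more than [k]
   coordinates were not unimodular, [E] would contain a nonzero direction [b] supported on them. *)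
case: (ex_maxnP P0 Pn) => c /asboolP[a [a1 aE] ca] cmax.
have {}cmax a' : good a' -> (cnt a' <= c)%N.
  by move=> ga; apply: cmax; apply/asboolP; exists a'.
exists a; split=> //; rewrite -/(cnt a).
apply: (@leq_ltn_trans (k + cnt a)); last by rewrite ltn_add2r.
rewrite leqNgt; apply/negP => hlt.
pose I := (~: [set i | ab (a i) == 1])%SET.
have cI : (k < #|I|)%N.
  have := cardsC [set i | ab (a i) == 1]%SET; rewrite card_ord -/(cnt a) -/I; lia.
have [v [i0 vi0] vE] := codim_dependent (fun p : 'I_#|I| => x (enum_val p)) cI hy.
pose b := zero_ext 0 (@enum_val _ (mem I)) v.
have evI : injective (@enum_val _ (mem I)) by exact: enum_val_inj.
have bE : cs_set E (\sum_i b i *: x i).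
  rewrite (sum_codom evI).
    by under eq_bigr do rewrite /b zero_extE//.
  by move=> i ni; rewrite /b zero_ext_out// scale0r.
have bI i : b i != 0 -> ab (a i) < 1.
  move=> bi; rewrite lt_neqAle a1 andbT.
  have : i \in codom (@enum_val _ (mem I)).
    by apply: contraNT bi => ni; rewrite /b zero_ext_out.
  by case/codomP => p ->; have := enum_valP p; rewrite !inE.
pose i1 := enum_val i0.
have bi1 : b i1 != 0 by rewrite /b zero_extE.
have /choice[tau tauP] : forall i, exists t : R, b i != 0 ->
    [/\ 0 < t, ab (a i + rl t * b i) = 1 &
      forall u, 0 <= u <= t -> ab (a i + rl u * b i) <= 1].
  move=> i; have [bi|bi] := eqVneq (b i) 0; first by exists 0.
  by have [t t0 [t1 tu]] := push_to_circle (bI _ bi) bi; exists t.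
(* The first coordinate to reach the circle: stopping there keeps all the others in the disc and
   gains a unimodular coordinate. *)
pose j := [arg min_(i < i1 | b i != 0) tau i]%O.
have [bj jmin] : b j != 0 /\ forall i, b i != 0 -> tau j <= tau i.
  by rewrite /j; case: arg_minP.
have [tj0 tj1 _] := tauP _ bj.
pose a' i := a i + rl (tau j) * b i.
have ga' : good a'.
  split=> [i|].
    have [bi|bi] := eqVneq (b i) 0; first by rewrite /a' bi mulr0 addr0.
    have [_ _] := tauP _ bi; apply; by rewrite (ltW tj0) jmin.
  have -> : \sum_i a' i *: x i =
      \sum_i a i *: x i + rl (tau j) *: \sum_i b i *: x i.
    rewrite scaler_sumr -big_split; apply: eq_bigr => i _.
    by rewrite scalerDl scalerA.
  by apply: closed_subspaceD => //; exact: closed_subspaceZ.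
have := cmax _ ga'; apply/negP; rewrite -ltnNge.
apply: leq_ltn_trans ca _; apply: proper_card; apply/properP; split.
  apply/fintype.subsetP => i; rewrite !inE => /eqP ai.
  suff b0 : b i = 0 by rewrite /a' b0 mulr0 addr0 ai.
  by have [//|/bI] := eqVneq (b i) 0; rewrite ai ltxx.
exists j; rewrite !inE /a' ?tj1 ?eqxx//.
by have := bI _ bj; rewrite lt_neqAle => /andP[].
Qed.

End UnimodularVectors.

(** * Operators, ideals and s-numbers *)

Section Operators.
Variables (R : realType) (s : scalars).
Local Notation K := (scalar_field R s).
Implicit Types W X Y Z : banachType R s.

Lemma pos_rl (e : K) : 0 < e -> exists2 r : R, 0 < r & e = rl r.
Proof.
move=> e0; have eE := ge0_rl (ltW e0); exists (scalar_re e) => //.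
by rewrite -(@rl_lt R s) -eE rl0.
Qed.

Lemma bounded_op_of_le X Y (T : X -> Y) (C : R) : linear T ->
  (forall x, rnorm (T x) <= C * rnorm x) -> bounded_op T.
Proof.
move=> lT hC; split=> // x; apply/cvgrPdist_lt => e e0.
have TB u v : T (u - v) = T u - T v.
  by rewrite -scaleN1r addrC lT scaleN1r addrC.
have [r r0 ->] := pos_rl e0.
pose D := `|C| + 1.
have D0 : 0 < D by rewrite ltr_pwDr.
apply/nbhs_normP; exists (rl (r / D)) => /=.
  by rewrite -(@rl0 R s) rl_lt divr_gt0.
move=> y; rewrite /= !rnormE !rl_lt -TB => h.
apply: le_lt_trans (hC _) _.
apply: (@le_lt_trans _ _ (D * rnorm (x - y))).
  rewrite ler_wpM2r ?rnorm_ge0// /D; have := ler_norm C; lra.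
by rewrite mulrC -ltr_pdivlMr.
Qed.

Lemma linear0_eq X Y (T : X -> Y) : linear T -> T 0 = 0.
Proof. by move=> lT; have := lT (-1) 0 0; rewrite scaler0 addr0 scaleN1r addNr. Qed.

Lemma linearD_eq X Y (T : X -> Y) x y : linear T -> T (x + y) = T x + T y.
Proof. by move=> lT; have := lT 1 x y; rewrite !scale1r. Qed.

Lemma linearZ_eq X Y (T : X -> Y) (a : K) x : linear T -> T (a *: x) = a *: T x.
Proof.
by move=> lT; have := lT a x 0; rewrite (linear0_eq lT) !addr0.
Qed.

Lemma linear_sum_eq X Y (T : X -> Y) (I : finType) (F : I -> X) : linear T ->
  T (\sum_i F i) = \sum_i T (F i).
Proof.
move=> lT; apply: (big_morph T) => [x y|]; first exact: linearD_eq.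
exact: linear0_eq.
Qed.

Lemma opnorm_le X Y (T : X -> Y) (C : R) : 0 <= C ->
  (forall x, rnorm (T x) <= C * rnorm x) -> (opnorm T <= C%:E)%E.
Proof.
move=> C0 hC; apply: ge_ereal_sup => _ [x x1 <-]; rewrite lee_fin.
by apply: le_trans (hC x) _; rewrite ler_piMr.
Qed.

Lemma le_opnorm X Y (T : X -> Y) x : rnorm x <= 1 ->
  ((rnorm (T x))%:E <= opnorm T)%E.
Proof. by move=> x1; apply: ereal_sup_ubound; exists x. Qed.

Lemma opnorm_ge0 X Y (T : X -> Y) : (0 <= opnorm T)%E.
Proof.
apply: le_trans (@le_opnorm X Y T 0 _); first by rewrite lee_fin rnorm_ge0.
by rewrite rnorm0.
Qed.

Lemma bounded_op_id X : bounded_op (fun x : X => x).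
Proof. by apply: (@bounded_op_of_le _ _ _ 1) => // x; rewrite mul1r. Qed.

Lemma opnorm_id_le X : (opnorm (fun x : X => x) <= 1)%E.
Proof. by apply: opnorm_le => // x; rewrite mul1r. Qed.

Lemma rnorm_incl X (E : closed_subspace X) (x : subspace_of E) :
  rnorm (Defs.incl x) = rnorm x.
Proof. by []. Qed.

Lemma bounded_op_incl X (E : closed_subspace X) :
  bounded_op (Defs.incl : subspace_of E -> X).
Proof.
by apply: (@bounded_op_of_le _ _ _ 1) => // x; rewrite mul1r rnorm_incl.
Qed.

Lemma opnorm_incl_le X (E : closed_subspace X) :
  (opnorm (Defs.incl : subspace_of E -> X) <= 1)%E.
Proof. by apply: opnorm_le => // x; rewrite mul1r rnorm_incl. Qed.

Lemma bounded_op_rank1 X Y (f : functional X) (y : Y) :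
  bounded_op (fun x => f x *: y).
Proof.
apply: (@bounded_op_of_le _ _ _ (rnorm y)).
  by move=> a u v; rewrite fvalD fvalZ scalerDl scalerA.
by move=> x; rewrite rnormZ mulrC ler_wpM2l ?rnorm_ge0 ?fval_le.
Qed.

Lemma opnorm_rank1_le X Y (f : functional X) (y : Y) :
  (opnorm (fun x => f x *: y) <= (rnorm y)%:E)%E.
Proof.
apply: opnorm_le; first exact: rnorm_ge0.
by move=> x; rewrite rnormZ mulrC ler_wpM2l ?rnorm_ge0 ?fval_le.
Qed.

Definition rank_le (k : nat) X Y (u : X -> Y) : Prop :=
  exists y : 'I_k -> Y, forall x, exists c : 'I_k -> K,
    u x = \sum_(i < k) c i *: y i.

Lemma rank_leD k l X Y (u v : X -> Y) : rank_le k u -> rank_le l v ->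
  rank_le (k + l) (fun x => u x + v x).
Proof.
move=> [y hy] [z hz].
exists (fun i => match fintype.split i with inl j => y j | inr j => z j end) => x.
have [c cE] := hy x; have [d dE] := hz x.
exists (fun i => match fintype.split i with inl j => c j | inr j => d j end).
rewrite big_split_ord /= cE dE; congr (_ + _); apply: eq_bigr => i _.
  by rewrite -[lshift l i]/(unsplit (inl i)) unsplitK.
by rewrite -[rshift k i]/(unsplit (inr i)) unsplitK.
Qed.

Lemma rank_le_sum (n : nat) (k : nat -> nat) X Y (U : nat -> X -> Y) :
  (forall j, rank_le (k j) (U j)) ->
  rank_le (\sum_(j < n) k j) (fun x => \sum_(j < n) U j x).
Proof.
move=> hU; elim: n => [|n ih].
  rewrite big_ord0; exists (fun=> 0) => x; exists (fun=> 0).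
  by rewrite !big_ord0.
have -> : (fun x => \sum_(j < n.+1) U j x) = (fun x => \sum_(j < n) U j x + U n x).
  by apply/funext => x; rewrite big_ord_recr.
by rewrite big_ord_recr /=; exact: rank_leD.
Qed.

(** A family [z] of maximal size with linearly independent images spans [X] modulo the kernel, and
    its size is at most the [k] of the rank bound. *)
Lemma rank_lt_kernel_codim m X Y (u : X -> Y) (E : closed_subspace X) :
  linear u -> (forall x, cs_set E x <-> u x = 0) -> rank_lt m u -> codim_lt m E.
Proof.
move=> lu hE [k km [y hy]].
pose indep r (z : 'I_r -> X) := forall v : 'I_r -> K,
  \sum_i v i *: u (z i) = 0 -> forall i, v i = 0.
pose P r := `[< exists z, @indep r z >].
have P0 : exists r, P r.
  by exists 0%N; apply/asboolP; exists (fun=> 0) => v _ [].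
have Pk r : P r -> (r <= k)%N.
  move=> /asboolP[z zi]; rewrite leqNgt; apply/negP => kr.
  have /choice[c cE] := fun i => hy (z i).
  have [v v0 vM] := exists_kernel_vector (\matrix_(i < r, l < k) c i l) kr.
  move/eqP: v0; apply; apply/rowP => i; rewrite mxE; apply: (zi (v 0)).
  under eq_bigr do rewrite cE scaler_sumr.
  rewrite exchange_big /= big1// => l _.
  under eq_bigr do rewrite scalerA.
  rewrite -scaler_suml.
  have := congr1 (fun N : 'rV_k => N 0 l) vM; rewrite !mxE.
  by under eq_bigr do rewrite mxE; move=> ->; rewrite scale0r.
case: (ex_maxnP P0 Pk) => r /asboolP[z zi] rmax.
exists r; first by apply: leq_ltn_trans km; apply: Pk; apply/asboolP; exists z.
exists z => x.
pose z' (i : 'I_r.+1) := if unlift ord0 i is Some j then z j else x.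
have [v vE [i vi]] : exists2 v : 'I_r.+1 -> K,
    \sum_i v i *: u (z' i) = 0 & exists i, v i != 0.
  apply: contrapT => nv; have nP : ~ P r.+1 by move=> /rmax; rewrite ltnn.
  apply: nP.
  apply/asboolP; exists z' => v vE i; apply/eqP; rewrite -[_ == _]negbK.
  by apply/negP => vi; apply: nv; exists v => //; exists i.
move: vE; rewrite big_ord_recl /z' unlift_none.
under eq_bigr do rewrite liftK.
move=> vE.
have v0 : v ord0 != 0.
  apply/eqP => v00; move: vE; rewrite v00 scale0r add0r => /zi vz.
  move: vi; case: (unliftP ord0 i) => [j ->|->]; last by rewrite v00 eqxx.
  by rewrite (vz j) eqxx.
exists (fun j => - (v (lift ord0 j) / v ord0)); apply/hE.
have uB a b : u (a - b) = u a - u b.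
  by rewrite linearD_eq// -scaleN1r linearZ_eq// scaleN1r.
rewrite uB linear_sum_eq//.
under eq_bigr do rewrite linearZ_eq// scaleNr -mulrC -scalerA.
rewrite sumrN opprK -scaler_sumr.
by apply: (scalerI v0); rewrite scalerDr scalerA mulfV// scale1r scaler0.
Qed.

Lemma kernel_subspace X Y (u : X -> Y) : bounded_op u ->
  exists E : closed_subspace X, forall x, cs_set E x <-> u x = 0.
Proof.
move=> [lu cu]; pose S := u @^-1` [set 0].
have Ssub : submod_closed [pred x | x \in S].
  split; first by rewrite inE /S /=; exact: linear0_eq.
  move=> a x y; rewrite !inE /S /= => ux uy.
  by rewrite lu ux uy scaler0 addr0.
have Scl : closed S.
  move/continuous_closedP: cu; apply.
  by apply: accessible_closed_set1; apply: hausdorff_accessible; exact: norm_hausdorff.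
by exists (ClosedSubspace Ssub Scl).
Qed.

Variable A : banach_ideal R s.

Lemma inorm_le_rank1 X Y (f : functional X) (y : Y) :
  (inorm A (fun x => f x *: y) <= (rnorm y)%:E)%E.
Proof.
rewrite inorm_rank1; first exact: opnorm_rank1_le.
  exact: bounded_op_rank1.
exists 1%N => //; exists (fun=> y) => x; exists (fun=> f x).
by rewrite big_ord1.
Qed.

Lemma inorm_zero X Y : inorm A (fun _ : X => 0 : Y) = 0%E.
Proof.
have [f _] := norming_functional (0 : X).
apply/eqP; rewrite eq_le inorm_ge0 andbT.
have := inorm_le_rank1 f (0 : Y); rewrite rnorm0.
by under eq_fun do rewrite scaler0.
Qed.

Lemma inorm_sum_le X Y (I : Type) (r : seq I) (F : I -> X -> Y) (c : I -> R) :
  (forall i, (inorm A (F i) <= (c i)%:E)%E) ->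
  (inorm A (fun x => (\sum_(i <- r) F i x)%R) <= (\sum_(i <- r) c i)%:E)%E.
Proof.
move=> Fc; elim: r => [|i r ih].
  by under eq_fun do rewrite big_nil; rewrite big_nil inorm_zero.
under eq_fun do rewrite big_cons; rewrite big_cons EFinD.
apply: le_trans (inormD _ _) _.
- by apply: le_lt_trans (Fc i) _; exact: ltry.
- by apply: le_lt_trans ih _; exact: ltry.
- exact: leeD.
Qed.

Lemma inormN X Y (T : X -> Y) : (inorm A T < +oo)%E ->
  inorm A (fun x => - T x) = inorm A T.
Proof.
move=> T1; under eq_fun do rewrite -scaleN1r.
rewrite inormZ//.
have -> : scalar_re `|-1 : K| = 1 by rewrite normrN1 -(@rl1 R s) re_rl.
by rewrite mul1e.
Qed.

(* Compose [T] with the rank one operator [g (x) x], where [g] norms [x]. *)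
Lemma rnorm_le_inorm X Y (T : X -> Y) x :
  (inorm A T < +oo)%E -> ((rnorm (T x))%:E <= inorm A T * (rnorm x)%:E)%E.
Proof.
move=> Tfin; have [lT cT] := inorm_bounded_op Tfin.
have [x0|x0] := eqVneq (rnorm x) 0.
  by rewrite (rnorm0_eq0 x0) (linear0_eq lT) !rnorm0 mule0.
have [g gE] := norming_functional x.
pose u (z : X) := g z *: x.
have bu : bounded_op u by exact: bounded_op_rank1.
have TuE : T \o u = (fun z => g z *: T x).
  by apply/funext => z; rewrite /u /= linearZ_eq.
have Tu : inorm A (T \o u) = opnorm (T \o u).
  apply: inorm_rank1; first by rewrite TuE; exact: bounded_op_rank1.
  exists 1%N => //; exists (fun=> T x) => z; exists (fun=> g z).
  by rewrite big_ord1 TuE.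
apply: (@le_trans _ _ (opnorm (T \o u))).
  have xz : rnorm ((rl (rnorm x)^-1 : K) *: x) = 1.
    by rewrite rnorm_rlZ ger0_norm ?invr_ge0 ?rnorm_ge0// mulVf.
  apply: le_trans (@le_opnorm _ _ (T \o u) ((rl (rnorm x)^-1 : K) *: x) _).
    by rewrite TuE fvalZ gE -rlM mulVf// rl1 scale1r.
  by rewrite xz.
rewrite -Tu; have := inorm_comp bu Tfin (bounded_op_id Y).
rewrite (_ : (fun x => x) \o T \o u = T \o u)//; move=> /le_trans; apply.
apply: lee_pmul; rewrite ?mule_ge0 ?opnorm_ge0 ?inorm_ge0//.
  by rewrite -[leRHS]mul1e; apply: lee_wpmul2r; rewrite ?inorm_ge0 ?opnorm_id_le.
exact: opnorm_rank1_le.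
Qed.

Lemma opnorm_le_inorm X Y (T : X -> Y) : (opnorm T <= inorm A T)%E.
Proof.
have [Tfin|] := ltP (inorm A T) +oo%E; last by rewrite leye_eq => /eqP ->; rewrite leey.
apply: ge_ereal_sup => _ [x x1 <-].
apply: le_trans (rnorm_le_inorm x Tfin) _.
by rewrite -[leRHS]mule1; apply: lee_wpmul2l; rewrite ?inorm_ge0// lee_fin.
Qed.

Lemma inorm_restrict_le X Y (T : X -> Y) (E : closed_subspace X) :
  (inorm A (T \o @Defs.incl _ _ E) <= inorm A T)%E.
Proof.
have [Tfin|] := ltP (inorm A T) +oo%E; last by rewrite leye_eq => /eqP ->; rewrite leey.
have := inorm_comp (bounded_op_incl E) Tfin (bounded_op_id Y).
move=> /le_trans; apply; rewrite -[leRHS]mule1.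
apply: lee_pmul; rewrite ?mule_ge0 ?opnorm_ge0 ?inorm_ge0 ?opnorm_incl_le//.
by rewrite -[leRHS]mul1e; apply: lee_wpmul2r; rewrite ?inorm_ge0 ?opnorm_id_le.
Qed.

Lemma gelfand_le_ideal_gelfand m X Y (T : X -> Y) :
  (gelfand m T <= ideal_gelfand A m T)%E.
Proof.
apply: le_ereal_inf_tmp => _ [E hE <-]; apply: le_trans (opnorm_le_inorm _).
by apply: ereal_inf_lbound; exists E.
Qed.

Lemma ideal_gelfand_le_ideal_approx m X Y (T : X -> Y) :
  (ideal_gelfand A m T <= ideal_approx A m T)%E.
Proof.
apply: le_ereal_inf_tmp => _ [u [bu ru] <-].
have [E hE] := kernel_subspace bu.
apply: le_trans (inorm_restrict_le (fun x => T x - u x) E).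
apply: ereal_inf_lbound; exists E.
  by apply: (rank_lt_kernel_codim _ hE ru); case: bu.
congr inorm; apply/funext => x /=.
have := set_mem (valP x) => /hE ux.
by rewrite (_ : u (Defs.incl x) = 0) ?subr0.
Qed.

End Operators.

(** * Operator series whose terms are dominated by the differences of a null sequence *)

Section Series.
Variables (R : realType) (s : scalars).
Local Notation K := (scalar_field R s).
Implicit Types X Y : banachType R s.

Lemma cauchy_limit Y (y : nat -> Y) (t : nat -> R) :
  (forall m n, (m <= n)%N -> rnorm (y n - y m) <= t m) ->
  t @ \oo --> (0 : R) -> exists l, forall m, rnorm (l - y m) <= t m.
Proof.
move=> yt t0.
have small e : 0 < e -> exists N, forall n, (N <= n)%N -> t n < e.
  move=> e0; have /cvgr0Pnorm_lt/(_ _ e0)[N _ HN] := t0; exists N => n Nn.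
  by apply: le_lt_trans (ler_norm _) _; exact: HN.
have : cvg (y @ \oo).
  apply: cauchy_cvg; apply/cauchy_ballP => e e0.
  have [r r0 eE] := pos_rl e0.
  have [|N HN] := small (r / 2); first by rewrite divr_gt0.
  exists ([set y n | n in [set n | (N <= n)%N]], [set y n | n in [set n | (N <= n)%N]]).
    by split; exists N => // n Nn; exists n.
  move=> [_ _] [[m Nm <-] [n Nn <-]] /=; rewrite -ball_normE /= rnormE eE rl_lt.
  have := yt _ _ Nm; have := yt _ _ Nn; have := HN _ (leqnn N).
  have -> : y m - y n = (y m - y N) - (y n - y N) by rewrite opprB addrA subrK.
  have := rnormB (y m - y N) (y n - y N); lra.
move=> /cvg_ex[l yl]; exists l => m; apply/ler_addgt0Pr => e e0.
have : 0 < (rl e : K) by rewrite -(@rl0 R s) rl_lt.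
move/cvgrPdist_lt: yl => /[apply] -[N _ HN].
have := HN (maxn N m) (leq_maxl _ _); rewrite /= rnormE rl_lt.
have := yt _ _ (leq_maxr N m); set n := maxn N m.
have -> : l - y m = (l - y n) + (y n - y m) by rewrite addrA subrK.
have := rnormD (l - y n) (y n - y m); lra.
Qed.

Variables (X Y : banachType R s) (U : nat -> X -> Y) (t : nat -> R).
Hypothesis U_linear : forall j, linear (U j).
Hypothesis U_le : forall j x, rnorm (U j x) <= (t j - t j.+1) * rnorm x.
Hypothesis t_ge0 : forall j, 0 <= t j.
Hypothesis t_cvg0 : t @ \oo --> (0 : R).

Let S n x := \sum_(j < n) U j x.

Lemma telescope_le m n : (m <= n)%N ->
  \sum_(m <= j < n) (t j - t j.+1) <= t m.
Proof.
move=> mn; have -> : \sum_(m <= j < n) (t j - t j.+1) = t m - t n.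
  rewrite -[RHS]opprB -telescope_sumr// -sumrN.
  by apply: eq_bigr => j _; rewrite opprB.
by rewrite gerBl.
Qed.

Lemma partial_sumB m n x : (m <= n)%N ->
  S n x - S m x = \sum_(m <= j < n) U j x.
Proof.
move=> mn; rewrite /S -!(big_mkord xpredT (fun j => U j x)).
by rewrite [X in X - _](@big_cat_nat _ _ _ m)//= addrAC subrr add0r.
Qed.

Lemma exists_series_op : exists2 T : X -> Y, bounded_op T &
  forall n x, rnorm (T x - S n x) <= t n * rnorm x.
Proof.
have /choice[T hT] : forall x, exists l, forall n, rnorm (l - S n x) <= t n * rnorm x.
  move=> x; apply: cauchy_limit; last first.
    rewrite -[X in _ --> X](mul0r (rnorm x)); exact: cvgMl.
  move=> m n mn; rewrite partial_sumB//; apply: le_trans (rnorm_sum _ _ _) _.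
  apply: (@le_trans _ _ (\sum_(m <= j < n) (t j - t j.+1) * rnorm x)).
    by apply: ler_sum => j _; exact: U_le.
  by rewrite -mulr_suml ler_wpM2r ?rnorm_ge0// telescope_le.
exists T => //; apply: (@bounded_op_of_le _ _ _ _ _ (t 0%N)); last first.
  by move=> x; have := hT x 0%N; rewrite /S big_ord0 subr0.
have SL n a x y : S n (a *: x + y) = a *: S n x + S n y.
  rewrite /S scaler_sumr -big_split; apply: eq_bigr => j _; exact: U_linear.
move=> a x y; apply/eqP; rewrite -subr_eq0; apply/eqP; apply: rnorm0_eq0.
apply/eqP; rewrite eq_le rnorm_ge0 andbT; apply/ler_addgt0Pr => e e0.
rewrite add0r.
pose C := rnorm (a *: x + y) + (ab a * rnorm x + rnorm y) + 1.
have C0 : 0 < C.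
  by rewrite /C ltr_pwDr// !addr_ge0 ?mulr_ge0 ?ab_ge0 ?rnorm_ge0.
have /cvgr0Pnorm_lt/(_ _ (divr_gt0 e0 C0))[N _ /(_ N (leqnn N))/=] := t_cvg0.
rewrite ger0_norm// ltr_pdivlMr// => tN.
have -> : T (a *: x + y) - (a *: T x + T y) =
    (T (a *: x + y) - S N (a *: x + y)) - (a *: (T x - S N x) + (T y - S N y)).
  rewrite SL scalerBr; set p := T _; set q := a *: T x; set r := a *: S N x.
  have -> : q - r + (T y - S N y) = (q + T y) - (r + S N y).
    by rewrite opprD addrACA.
  by rewrite opprB addrA subrK.
apply: le_trans (rnormB _ _) _.
have h1 := hT (a *: x + y) N.
have h2 := hT x N; have h3 := hT y N.
have h4 := rnormD (a *: (T x - S N x)) (T y - S N y); rewrite rnormZ in h4.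
have h5 := ler_wpM2l (ab_ge0 a) h2.
have := t_ge0 N; rewrite /C in tN; lra.
Qed.

(** The partial sums are Cauchy in the ideal norm, so completeness provides a limit [T'] there. The
    ideal norm dominates the operator norm, hence [T'] is the [T] already given, whichever ideal is
    considered. *)
Lemma inorm_remainder_le (A : banach_ideal R s) (T : X -> Y) :
  (forall n x, rnorm (T x - S n x) <= t n * rnorm x) ->
  (forall j, (inorm A (U j) <= (t j - t j.+1)%:E)%E) ->
  forall n, (inorm A (fun x => T x - S n x)%R <= (t n)%:E)%E.
Proof.
move=> hT hU n.
have small e : 0 < e -> exists N, forall n, (N <= n)%N -> t n < e.
  move=> e0; have /cvgr0Pnorm_lt/(_ _ e0)[N _ HN] := t_cvg0; exists N => k Nk.
  by apply: le_lt_trans (ler_norm _) _; exact: HN.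
have Sle p q : (p <= q)%N -> (inorm A (fun x => S q x - S p x)%R <= (t p)%:E)%E.
  move=> pq; have -> : (fun x => S q x - S p x) = (fun x => \sum_(p <= j < q) U j x).
    by apply/funext => x; exact: partial_sumB.
  apply: le_trans (inorm_sum_le _ hU) _.
  by rewrite lee_fin telescope_le.
have Sle' p q : (q <= p)%N -> (inorm A (fun x => S q x - S p x)%R <= (t q)%:E)%E.
  move=> qp; under eq_fun do rewrite -opprB.
  by rewrite inormN ?Sle//; apply: le_lt_trans (Sle _ _ qp) _; exact: ltry.
have Sfin p : (inorm A (S p) < +oo)%E.
  have -> : S p = (fun x => S p x - S 0%N x).
    by apply/funext => x; rewrite /S big_ord0 subr0.
  by apply: le_lt_trans (Sle _ _ (leq0n p)) _; exact: ltry.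
have [|T' T'fin cT'] := inorm_complete Sfin.
  move=> e e0; have [N HN] := small _ e0; exists N => p q Np Nq.
  have [pq|qp] := leqP p q.
    by apply: le_trans (Sle' _ _ pq) _; rewrite lee_fin ltW// HN.
  by apply: le_trans (Sle _ _ (ltnW qp)) _; rewrite lee_fin ltW// HN.
have close e : 0 < e -> exists2 N, (n <= N)%N &
    t N < e /\ (inorm A (fun x => S N x - T' x)%R < e%:E)%E.
  move=> e0; have [N1 HN1] := small _ e0.
  have : \forall k \near \oo, (inorm A (fun x => S k x - T' x)%R < e%:E)%E.
    have : nbhs 0%E [set z : \bar R | (z < e%:E)%E].
      by apply: open_nbhs_nbhs; split; [exact: open_ereal_lt_ereal|rewrite /= lte_fin].
    by move/cT'.
  move=> [N2 _ HN2]; exists (maxn n (maxn N1 N2)); first exact: leq_maxl.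
  split; first by apply: HN1; rewrite !leq_max leqnn orbT.
  by apply: HN2; rewrite /= !leq_max leqnn !orbT.
have TT' : T' = T.
  apply/funext => x; apply/eqP; rewrite eq_sym -subr_eq0; apply/eqP.
  apply: rnorm0_eq0; apply/eqP; rewrite eq_le rnorm_ge0 andbT.
  apply/ler_addgt0Pr => e e0; rewrite add0r.
  pose C := 2 * rnorm x + 1.
  have C0 : 0 < C by rewrite ltr_pwDr// mulr_ge0 ?rnorm_ge0.
  have [N _ [tN iN]] := close _ (divr_gt0 e0 C0).
  have fin : (inorm A (fun x => S N x - T' x)%R < +oo)%E.
    by apply: lt_trans iN _; exact: ltry.
  have h1 : rnorm (S N x - T' x) <= e / C * rnorm x.
    rewrite -lee_fin; apply: le_trans (rnorm_le_inorm x fin) _.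
    by rewrite EFinM; apply: lee_wpmul2r; rewrite ?lee_fin ?rnorm_ge0// ltW.
  have h2 : t N * rnorm x <= e / C * rnorm x by rewrite ler_wpM2r ?rnorm_ge0// ltW.
  have -> : T x - T' x = (T x - S N x) + (S N x - T' x) by rewrite addrA subrK.
  apply: le_trans (rnormD _ _) _.
  have h3 := hT N x.
  have q0 : 0 <= e / C by rewrite divr_ge0// ltW.
  have eE : e = e / C * (2 * rnorm x + 1) by rewrite -/C divfK// gt_eqF.
  rewrite [leRHS]eE; move: h1 h2 q0; move: (e / C) => q h1 h2 q0; lra.
apply/lee_addgt0Pr => e e0.
have [N nN [_ iN]] := close _ e0; rewrite TT' in iN.
have -> : (fun x => T x - S n x) = (fun x => - (S N x - T x) + (S N x - S n x)).
  by apply/funext => x; rewrite opprB addrA subrK.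
have fin : (inorm A (fun x => S N x - T x)%R < +oo)%E.
  by apply: lt_trans iN _; exact: ltry.
apply: le_trans (inormD _ _) _.
- by rewrite inormN.
- by apply: le_lt_trans (Sle _ _ nN) _; exact: ltry.
- by rewrite inormN// addeC; apply: leeD; [exact: Sle|exact: ltW].
Qed.

End Series.

(** * Construction of the operator *)

(** Dependent choice in varying types. The history is a total function and step [j] changes only its
    entry [j], so entry [l] is final after step [l]. *)
Lemma exists_with_history (B : nat -> Type) (b0 : forall l, B l)
    (Q : forall j, B j -> Prop) (S : forall j l, B l -> B j -> Prop) :
  (forall j (h : forall l, B l), exists b : B j,
    Q j b /\ forall l, (l < j)%N -> S j l (h l) b) ->
  exists b : forall l, B l, (forall j, Q j (b j)) /\
    forall l j, (l < j)%N -> S j l (b l) (b j).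
Proof.
move=> step.
have /choice[next nextP] : forall jh : nat * (forall l, B l),
    exists h' : forall l, B l,
    [/\ forall l, l != jh.1 -> h' l = jh.2 l, Q jh.1 (h' jh.1) &
      forall l, (l < jh.1)%N -> S jh.1 l (jh.2 l) (h' jh.1)].
  move=> [j h]; have [b [Qb Sb]] := step j h.
  exists (dfwith h j b) => /=; split; rewrite ?dfwithin//.
  by move=> l lj; rewrite dfwithout// eq_sym.
pose H := fix H j := if j is j'.+1 then next (j', H j') else b0.
have HE k l : (l < k)%N -> H k l = H l.+1 l.
  elim: k => // k ih; rewrite ltnS leq_eqVlt => /predU1P[->//|lk].
  have [h _ _] := nextP (k, H k).
  by rewrite -ih//= h//= ltn_eqF.
exists (fun l => H l.+1 l); split=> [j|l j lj].
  by have [] := nextP (j, H j).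
have [_ _ /(_ l lj) h] := nextP (j, H j).
by rewrite -(HE j).
Qed.

(** * Cut points adapted to the decay of [alpha] *)

Section IndexSequence.
Variables (R : realType) (alpha : nat -> R).
Hypothesis alpha_noninc : forall k, (1 <= k)%N -> alpha k.+1 <= alpha k.
Hypothesis alpha_ge0 : forall k, (1 <= k)%N -> 0 <= alpha k.
Hypothesis alpha_cvg0 : alpha @ \oo --> (0 : R).

Lemma alpha_le k l : (1 <= k)%N -> (k <= l)%N -> alpha l <= alpha k.
Proof.
move=> k1; elim: l => [|l ih]; first by rewrite leqn0 => /eqP ->.
rewrite leq_eqVlt => /predU1P[->//|]; rewrite ltnS => kl.
by apply: le_trans (ih kl); apply: alpha_noninc; exact: leq_trans kl.
Qed.

(* The least [M' >= 2 M] beyond which [alpha] is at most half of [alpha M]. *)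
Lemma exists_next_index M : (1 <= M)%N -> exists M',
  [/\ (2 * M <= M')%N, 2 * alpha M'.+1 <= alpha M &
      M' = (2 * M)%N \/ alpha M <= 2 * alpha M'].
Proof.
move=> M1.
have ex : exists M', (2 * M <= M')%N && (2 * alpha M'.+1 <= alpha M).
  have := alpha_ge0 M1; rewrite le_eqVlt => /predU1P[a0|a0].
    exists (2 * M)%N; rewrite leqnn /=.
    have h1 : alpha (2 * M).+1 <= alpha M by apply: alpha_le => //; lia.
    have := @alpha_ge0 (2 * M).+1 isT; lra.
  have /cvgr0Pnorm_lt/(_ _ (divr_gt0 a0 (ltr0Sn _ 1)))[N _ HN] := alpha_cvg0.
  exists (2 * M + N)%N; rewrite leq_addr /=.
  have hN : (N <= (2 * M + N).+1)%N by lia.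
  have := HN _ hN; rewrite /=; have := ler_norm (alpha (2 * M + N).+1); lra.
case: (ex_minnP ex) => M' /andP[h1 h2] hmin; exists M'; split=> //.
have [->|ne] := eqVneq M' (2 * M)%N; [by left|right].
rewrite leNgt; apply/negP => hlt.
have M'E : M' = M'.-1.+1 by lia.
have : (M' <= M'.-1)%N.
  by apply: hmin; rewrite -M'E ltW// andbT; lia.
lia.
Qed.

Lemma exists_index_sequence : exists M : nat -> nat, M 0%N = 1%N /\
  forall j, [/\ (2 * M j <= M j.+1)%N, 2 * alpha (M j.+1).+1 <= alpha (M j) &
      M j.+1 = (2 * M j)%N \/ alpha (M j) <= 2 * alpha (M j.+1)].
Proof.
have /choice[next nextP] : forall M, exists M', (1 <= M)%N ->
  [/\ (2 * M <= M')%N, 2 * alpha M'.+1 <= alpha M &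
      M' = (2 * M)%N \/ alpha M <= 2 * alpha M'].
  move=> M; case: (posnP M) => [->|M0]; first by exists 0%N.
  by have [M' hM'] := exists_next_index M0; exists M'.
pose M j := iter j next 1%N.
have M1 j : (1 <= M j)%N.
  elim: j => // j ih; have [h _ _] := nextP _ ih; apply: leq_trans h.
  by rewrite muln_gt0.
by exists M; split=> // j; exact: nextP.
Qed.

End IndexSequence.

Lemma ceil_nat_bounds (m : nat) : (1 <= m)%N ->
  (1 <= ceil_nat ((4 * m)%:R / 5) <= m)%N.
Proof.
move=> m1; rewrite /ceil_nat; set x : rat := _ / _.
have m1' : 1 <= (m%:R : rat) by rewrite ler1n.
have x0 : 0 < x by rewrite /x natrM; lra.
have xm : x <= m%:R by rewrite /x natrM; lra.
have c0 : 0 < Num.ceil x by rewrite ceil_gt0.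
have cm : Num.ceil x <= m by rewrite ceil_le_int.
by move: c0 cm; case: (Num.ceil x) => //= n; lia.
Qed.

(** Each block is chosen against all earlier ones, gathered in one sigma type. The later block of a
    pair adapts to the earlier, hence the error [eta (maxn l j)] in either order. *)
Lemma exists_blocks (R : realType) (s : scalars) (X : banachType R s)
    (n : nat -> nat) (eta : nat -> R) :
  no_nontrivial_cotype X -> (forall j, 0 < eta j) ->
  exists (x : forall j, 'I_(n j) -> X) (f : forall j, 'I_(n j) -> functional X),
  [/\ forall j (a : 'I_(n j) -> scalar_field R s), (forall i, ab (a i) <= 1) ->
        rnorm (\sum_i a i *: x j i) <= 3,
      forall j i l, ab (f j i (x j l) - (i == l)%:R) <= eta j &
      forall j l i k, l != j -> ab (f l i (x j k)) <= eta (maxn l j)].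
Proof.
move=> hX eta0.
pose B j := (('I_(n j) -> X) * ('I_(n j) -> functional X))%type.
have [f0 _] := norming_functional (0 : X).
pose Q j (b : B j) :=
  (forall a : 'I_(n j) -> scalar_field R s, (forall i, ab (a i) <= 1) ->
    rnorm (\sum_i a i *: b.1 i) <= 3) /\
  forall i l, ab (b.2 i (b.1 l) - (i == l)%:R) <= eta j.
pose C j l (h : B l) (b : B j) := forall i k,
  ab (h.2 i (b.1 k)) <= eta j /\ ab (b.2 k (h.1 i)) <= eta j.
have [|b [bQ bC]] := @exists_with_history B (fun=> (fun=> 0, fun=> f0)) Q C.
  move=> j h; pose I := {l : 'I_j & 'I_(n l)}.
  have [x [f [h1 h2 h3 h4]]] := @biorthogonal_block R s X I
    (fun p => (h (tag p)).1 (tagged p)) (fun p => (h (tag p)).2 (tagged p))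
    (n j) (eta j) hX (eta0 j).
  exists (x, f); split=> // l lj i k; split=> /=.
    exact: (h3 k (Tagged (fun l : 'I_j => 'I_(n l)) (i : 'I_(n (Ordinal lj))))).
  exact: (h4 k (Tagged (fun l : 'I_j => 'I_(n l)) (i : 'I_(n (Ordinal lj))))).
exists (fun j => (b j).1), (fun j => (b j).2); split.
- by move=> j; have [] := bQ j.
- by move=> j; have [] := bQ j.
- move=> j l i k; rewrite neq_ltn => /orP[lj|jl].
    by rewrite (maxn_idPr (ltnW lj)); have [] := bC _ _ lj i k.
  by rewrite (maxn_idPl (ltnW jl)); have [] := bC _ _ jl k i.
Qed.

(** * One block of the operator *)

Section DiagonalOperator.
Variables (R : realType) (s : scalars) (X Y : banachType R s).
Local Notation K := (scalar_field R s).
Variables (n : nat) (y : 'I_n -> Y) (w : R).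
Hypothesis n_gt0 : (0 < n)%N.
Hypothesis w_ge0 : 0 <= w.
Hypothesis y_le1 : forall i, rnorm (y i) <= 1.

(** The weight [w / n] makes the norms of the [n] rank one terms of [diag_op] add up to at most
    [w]. *)
Definition scaled_comb (d : 'I_n -> K) : Y :=
  \sum_i d i *: ((rl (w / n%:R) : K) *: y i).

Lemma scaled_term_le i : rnorm ((rl (w / n%:R) : K) *: y i) <= w / n%:R.
Proof.
have c0 : 0 <= w / n%:R by rewrite divr_ge0.
by rewrite rnorm_rlZ ger0_norm// ler_piMr.
Qed.

Lemma sum_weights : \sum_(i < n) w / n%:R = w.
Proof.
by rewrite sumr_const card_ord -[LHS]mulr_natr divfK// pnatr_eq0 -lt0n.
Qed.

Lemma scaled_comb_le (d : 'I_n -> K) (c : R) : (forall i, ab (d i) <= c) ->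
  rnorm (scaled_comb d) <= w * c.
Proof.
move=> dc; apply: le_trans (rnorm_sum _ _ _) _.
rewrite -{2}sum_weights mulr_suml; apply: ler_sum => i _.
rewrite rnormZ mulrC; apply: ler_pM => //; rewrite ?rnorm_ge0 ?ab_ge0//.
exact: scaled_term_le.
Qed.

Lemma scaled_combB (d e : 'I_n -> K) :
  scaled_comb d - scaled_comb e = scaled_comb (fun i => d i - e i).
Proof.
by rewrite -sumrB; apply: eq_bigr => i _; rewrite scalerBl.
Qed.

Lemma scaled_combE (d : 'I_n -> K) :
  scaled_comb d = (rl (w / n%:R) : K) *: \sum_i d i *: y i.
Proof.
by rewrite scaler_sumr; apply: eq_bigr => i _; rewrite !scalerA mulrC.
Qed.

Variable f : 'I_n -> functional X.

Definition diag_op (x : X) : Y := scaled_comb (fun i => f i x).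

Lemma diag_op_linear : linear diag_op.
Proof.
move=> a u v; rewrite /diag_op /scaled_comb scaler_sumr -big_split.
by apply: eq_bigr => i _; rewrite fvalD fvalZ scalerDl !scalerA ?mulrA.
Qed.

Lemma diag_op_le x : rnorm (diag_op x) <= w * rnorm x.
Proof. by apply: scaled_comb_le => i; exact: fval_le. Qed.

Lemma inorm_diag_op_le (A : banach_ideal R s) : (inorm A diag_op <= w%:E)%E.
Proof.
rewrite -[X in (_ <= X%:E)%E]sum_weights; apply: inorm_sum_le => i.
by apply: le_trans (inorm_le_rank1 _ _ _) _; rewrite lee_fin scaled_term_le.
Qed.

Lemma rank_le_diag_op : rank_le n diag_op.
Proof.
exists (fun i => (rl (w / n%:R) : K) *: y i) => x.
by exists (fun i => f i x).
Qed.

End DiagonalOperator.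

(** * The sum of the blocks is large on subspaces of small codimension *)

Section Construction.
Variables (R : realType) (s : scalars) (X Y : banachType R s).
Local Notation K := (scalar_field R s).
Variables (n : nat -> nat) (t b : nat -> R) (eta : nat -> R).
Variables (x : forall j, 'I_(n j) -> X) (f : forall j, 'I_(n j) -> functional X).
Variable y : forall j, 'I_(n j) -> Y.
Arguments x : clear implicits.
Arguments f : clear implicits.
Arguments y : clear implicits.
Let w j := t j - t j.+1.
Let U j := diag_op (y j) (w j) (f j).
Hypothesis n_gt0 : forall j, (0 < n j)%N.
Hypothesis w_ge0 : forall j, 0 <= w j.
Hypothesis t_ge0 : forall j, 0 <= t j.
Hypothesis t_cvg0 : t @ \oo --> (0 : R).
Hypothesis y_le1 : forall j i, rnorm (y j i) <= 1.
Hypothesis y_ge : forall j (a : 'I_(n j) -> K),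
  \sum_i ab (a i) <= 3 * rnorm (\sum_i a i *: y j i).
Hypothesis x_le : forall j (a : 'I_(n j) -> K), (forall i, ab (a i) <= 1) ->
  rnorm (\sum_i a i *: x j i) <= 3.
Hypothesis fx_diag : forall j i l,
  ab (f j i (x j l) - (i == l)%:R) <= eta j.
Hypothesis fx_off : forall j l i k, l != j ->
  ab (f l i (x j k)) <= eta (maxn l j).
Hypothesis eta_small : forall j l, 0 < b j -> w l = 0 \/
  (n j)%:R * eta (maxn l j) * t 0%N <= b j / 48.
Hypothesis b_le_w : forall j, b j <= w j.

Lemma diag_block_le (j : nat) (a : 'I_(n j) -> K) i : (forall k, ab (a k) <= 1) ->
  ab (f j i (\sum_k a k *: x j k) - a i) <= (n j)%:R * eta j.
Proof.
move=> a1.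
have -> : f j i (\sum_k a k *: x j k) - a i =
    \sum_k a k * (f j i (x j k) - (i == k)%:R).
  rewrite fval_sum; under [RHS]eq_bigr do rewrite mulrBr.
  rewrite sumrB; congr (_ - _); first by apply: eq_bigr => k _; rewrite fvalZ.
  rewrite (bigD1 i)//= eqxx mulr1 big1 ?addr0// => k ki.
  by rewrite eq_sym (negPf ki) mulr0.
apply: le_trans (ab_sum _ _ _) _.
rewrite mulr_natl -[X in _ *+ X](card_ord (n j)) -sumr_const.
apply: ler_sum => k _; rewrite abM -[leRHS]mul1r.
by apply: ler_pM; rewrite ?ab_ge0.
Qed.

Lemma off_block_le (j l : nat) (a : 'I_(n j) -> K) i : l != j ->
  (forall k, ab (a k) <= 1) ->
  ab (f l i (\sum_k a k *: x j k)) <= (n j)%:R * eta (maxn l j).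
Proof.
move=> lj a1; rewrite fval_sum; apply: le_trans (ab_sum _ _ _) _.
rewrite mulr_natl -[X in _ *+ X](card_ord (n j)) -sumr_const.
apply: ler_sum => k _; rewrite fvalZ abM -[leRHS]mul1r.
by apply: ler_pM; rewrite ?ab_ge0 ?fx_off.
Qed.

(** Up to errors, only block [j] sees [z], and it reads off the coefficients [a]; the l_1 estimate
    then gives at least (w_j / n_j) (1/3) (n_j / 2), hence [b j / 6]. The error of block [l] is
    proportional to [w l], and the weights sum to at most [t 0], so all errors together cost
    [b j / 48]. *)
Lemma partial_sum_lower (j N : nat) (a : 'I_(n j) -> K) : 0 < b j -> (j < N)%N ->
  (forall k, ab (a k) <= 1) -> (n j)%:R <= 2 * \sum_k ab (a k) ->
  b j / 6 - b j / 48 <= rnorm (\sum_(l < N) U l (\sum_k a k *: x j k)).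
Proof.
move=> bj jN a1 ha; set z := \sum_k a k *: x j k.
pose main := scaled_comb (y j) (w j) a.
have main_ge : b j / 6 <= rnorm main.
  rewrite /main scaled_combE rnorm_rlZ ger0_norm; last by rewrite divr_ge0.
  have nR : 0 < ((n j)%:R : R) by rewrite ltr0n.
  have h : (n j)%:R / 6 <= rnorm (\sum_i a i *: y j i).
    have := y_ge a; lra.
  have wn : 0 <= w j / (n j)%:R by rewrite divr_ge0.
  apply: le_trans (ler_wpM2l wn h).
  have -> : w j / (n j)%:R * ((n j)%:R / 6) = w j / 6 by field; lra.
  by rewrite ler_pM2r.
pose d l : Y := if l == j then U l z - main else U l z.
have dE : \sum_(l < N) U l z = main + \sum_(l < N) d l.
  rewrite (bigD1 (Ordinal jN))//= [in RHS](bigD1 (Ordinal jN))//=.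
  rewrite /d eqxx addrA addrCA subrr addr0; congr (_ + _).
  apply: eq_bigr => l lj; rewrite ifN//.
have dl l : rnorm (d l) <= w l * ((n j)%:R * eta (maxn l j)).
  rewrite /d; case: (eqVneq l j) => [->|lj].
    rewrite maxnn /U /diag_op scaled_combB; apply: scaled_comb_le => // i.
    exact: diag_block_le.
  by apply: scaled_comb_le => // i; exact: off_block_le.
have tpos : 0 <= t 0%N by [].
have dsum : rnorm (\sum_(l < N) d l) <= b j / 48.
  apply: le_trans (rnorm_sum _ _ _) _.
  have [t0|t0] := eqVneq (t 0%N) 0.
    rewrite big1 ?divr_ge0 ?(ltW bj)// => l _.
    apply/eqP; rewrite eq_le rnorm_ge0 andbT; apply: le_trans (dl l) _.
    have -> : w l = 0; last by rewrite mul0r.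
    have := telescope_le t_ge0 (leq0n l.+1).
    rewrite big_nat_recr//= t0 => h.
    have : 0 <= \sum_(0 <= i < l) (t i - t i.+1) by apply: sumr_ge0 => i _; exact: w_ge0.
    have := w_ge0 l; rewrite /w in h *; lra.
  have tp : 0 < t 0%N by rewrite lt0r t0.
  apply: (@le_trans _ _ (\sum_(l < N) w l * (b j / 48 / t 0%N))).
    apply: ler_sum => l _; apply: le_trans (dl l) _.
    have [->|h] := @eta_small j l bj; first by rewrite !mul0r.
    by rewrite ler_wpM2l// ler_pdivlMr.
  apply: (@le_trans _ _ (t 0%N * (b j / 48 / t 0%N))); last by rewrite mulrC divfK.
  rewrite -mulr_suml ler_wpM2r ?divr_ge0 ?(ltW bj)//.
  by rewrite -(big_mkord xpredT w); exact: telescope_le.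
rewrite dE -[\sum_(l < N) d l]opprK.
have := rnorm_distl main (- \sum_(l < N) d l); rewrite rnormN; lra.
Qed.

Lemma gelfand_lower (T : X -> Y) (j m : nat) : linear T -> (2 * m <= n j)%N ->
  (forall N z, rnorm (T z - \sum_(l < N) U l z) <= t N * rnorm z) ->
  ((b j / 24)%:E <= gelfand m T)%E.
Proof.
move=> lT hm hT; apply: le_ereal_inf_tmp => _ [E hE <-].
have [bj|bj] := leP (b j) 0.
  by apply: le_trans (opnorm_ge0 _); rewrite lee_fin; lra.
have [a [a1 aE acard]] := exists_unimodular (x j) hE.
(* As [2 * m <= n j], at least half of the coordinates are unimodular. *)
have ha : (n j)%:R <= 2 * \sum_k ab (a k).
  set S := [set i | ab (a i) == 1]%SET in acard.
  have hS : (n j <= 2 * #|S|)%N by lia.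
  apply: (@le_trans _ _ (2 * #|S|%:R)); first by rewrite -natrM ler_nat.
  rewrite ler_pM2l// -sum1_card natr_sum big_mkcond.
  apply: ler_sum => k _; case: ifP => [|_]; last exact: ab_ge0.
  by rewrite inE => /eqP ->.
set z := \sum_i a i *: x j i in aE.
have z3 : rnorm z <= 3 by exact: x_le.
have Tz : b j / 8 <= rnorm (T z).
  (* As [z] has norm at most 3, the tail costs at most [b j / 48], and 1/6 - 1/48 - 1/48 = 1/8. *)
  have /cvgr0Pnorm_lt/(_ (b j / 144)) := t_cvg0.
  have b144 : 0 < b j / 144 by rewrite divr_gt0.
  move=> /(_ b144)[N0 _ HN0]; pose N := maxn N0 j.+1.
  have := HN0 N (leq_maxl _ _); rewrite /= ger0_norm// => tN.
  have h1 := partial_sum_lower bj (leq_maxr N0 j.+1) a1 ha.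
  have h2 := hT N z.
  have h3 : t N * rnorm z <= b j / 144 * 3.
    by apply: ler_pM => //; rewrite ?rnorm_ge0// ltW.
  have h4 := rnorm_distl (\sum_(l < N) U l z) (\sum_(l < N) U l z - T z).
  rewrite opprB addrCA subrr addr0 in h4.
  rewrite -rnormN opprB in h2; rewrite -/z -/N in h1; lra.
pose z' : X := (rl 3^-1 : K) *: z.
have Ez' : z' \in cs_pred E by apply: mem_set; exact: closed_subspaceZ.
pose e : subspace_of E := exist _ z' Ez'.
have e1 : rnorm e <= 1.
  have -> : rnorm e = rnorm z' by [].
  by rewrite rnorm_rlZ ger0_norm//; lra.
apply: le_trans (@le_opnorm _ _ _ _ (T \o @Defs.incl _ _ E) e e1).
have -> : (T \o @Defs.incl _ _ E) e = (rl 3^-1 : K) *: T z.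
  by rewrite /= -linearZ_eq.
by rewrite lee_fin rnorm_rlZ ger0_norm//; lra.
Qed.

End Construction.

Theorem theorem1p6 (R : realType) (s : scalars) (alpha : nat -> R)
    (alpha_noninc : forall k, (1 <= k)%N -> alpha k.+1 <= alpha k)
    (alpha_ge0 : forall k, (1 <= k)%N -> 0 <= alpha k)
    (alpha_cvg0 : alpha @ \oo --> (0 : R))
    (X Y : banachType R s)
    (hX : no_nontrivial_cotype X) (hY : no_nontrivial_type Y) :
  exists2 T : X -> Y, bounded_op T &
    forall (m : nat) (A : banach_ideal R s),
      (1 <= m)%N -> injective_ideal A ->
      [/\ ((50^-1 * alpha (18 * m)%N)%:E <= gelfand m T)%E,
          (gelfand m T <= ideal_gelfand A m T)%E,
          (ideal_gelfand A m T <= ideal_approx A m T)%E &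
          (ideal_approx A m T
             <= (4 * alpha (ceil_nat ((4 * m)%:R / 5)))%:E)%E].
Proof.
have [M [M0 hM]] := exists_index_sequence alpha_noninc alpha_ge0 alpha_cvg0.
have M_double j : (2 * M j <= M j.+1)%N by have [] := hM j.
have M_ge j : (j < M j)%N.
  by elim: j => [|j ih]; [rewrite M0|have := M_double j; lia].
have M1 j : (1 <= M j)%N by exact: leq_ltn_trans (M_ge j).
have M_mono j k : (j <= k)%N -> (M j <= M k)%N.
  elim: k => [|k ih]; first by rewrite leqn0 => /eqP ->.
  rewrite leq_eqVlt => /predU1P[->//|]; rewrite ltnS => jk.
  by apply: leq_trans (ih jk) _; have := M_double k; lia.
have aM := alpha_le alpha_noninc.
pose b j := alpha (M j).
have b_ge0 j : 0 <= b j by exact: alpha_ge0.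
have b_mono j k : (j <= k)%N -> b k <= b j.
  by move=> jk; apply: aM => //; exact: M_mono.
(* The index sequence only guarantees halving just after [M j.+1]; [M j.+2] certainly lies beyond
   that. *)
have b_half j : 2 * b j.+2 <= b j.
  have [_ h _] := hM j; apply: le_trans h; rewrite ler_pM2l//.
  by apply: aM => //; have := M_double j.+1; have := M1 j.+1; lia.
(* [P j] is the total size of the first [j] blocks, a bound for the rank of their sum. *)
pose P j := if j is j'.+1 then M j' else 0%N.
pose n j := (P j.+1 - P j)%N.
have P_lt j : (P j < P j.+1)%N.
  by case: j => [|j] /=; [rewrite M0|have := M_double j; have := M1 j; lia].
have n_gt0 j : (0 < n j)%N by rewrite subn_gt0.
have n_le j : (n j <= M j)%N by rewrite leq_subr.
have n_ge j : (M j <= 2 * n j)%N.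
  by rewrite /n; case: j => [|j] /=; [rewrite M0|have := M_double j; lia].
have n_sum j : (\sum_(l < j) n l)%N = P j.
  elim: j => [|j ih]; first by rewrite big_ord0.
  by rewrite big_ord_recr /= ih /n subnKC// ltnW.
(* Halving after two steps makes the difference [2 * (b j - b j.+2)] at least [b j], while
   monotonicity keeps [t j] below [4 * b j]. *)
pose t j := 2 * (b j + b j.+1).
have t_ge0 j : 0 <= t j by rewrite mulr_ge0// addr_ge0.
have t_le j : t j <= 4 * b j by have := b_mono _ _ (leqnSn j); rewrite /t; lra.
have wE j : t j - t j.+1 = 2 * (b j - b j.+2) by rewrite /t; ring.
have w_ge0 j : 0 <= t j - t j.+1.
  rewrite wE; have := b_half j; have := b_ge0 j.+2; lra.
have b_le_w j : b j <= t j - t j.+1 by rewrite wE; have := b_half j; lra.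
have t_cvg0 : t @ \oo --> (0 : R).
  have h4 : (4 * alpha j.+1) @[j --> \oo] --> (0 : R).
    rewrite -[X in _ --> X](mulr0 4); apply: cvgMr.
    by have := cvg_shiftS alpha (nbhs (0 : R)) => ->.
  apply: (squeeze_cvgr _ (cvg_cst 0) h4); near=> j; rewrite t_ge0 /=.
  apply: le_trans (t_le j) _; rewrite ler_pM2l//; exact: aM.
(* Errors must be positive even where [alpha] vanishes, hence the default 1; the [+ 1] keeps the
   denominator positive. *)
pose eta j := (if b j == 0 then 1 else b j) / (48 * (t 0%N + 1) * (M j)%:R).
have M_gt0 j : 0 < ((M j)%:R : R) by rewrite ltr0n.
have t1 : 0 < t 0%N + 1 by rewrite ltr_pwDr.
have eta_gt0 j : 0 < eta j.
  rewrite divr_gt0 ?mulr_gt0//; case: eqVneq => // bj.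
  by rewrite lt0r bj b_ge0.
have eta_small j l : 0 < b j -> t l - t l.+1 = 0 \/
    (n j)%:R * eta (maxn l j) * t 0%N <= b j / 48.
  move=> bj; set k := maxn l j.
  have jk : (j <= k)%N by exact: leq_maxr.
  (* If [b k] vanishes while [b j] does not, then [k] is [l] and block [l] has weight zero, so its
     large [eta] is harmless. *)
  have [bk|bk] := eqVneq (b k) 0.
    left; have kl : k = l.
      rewrite /k; apply/maxn_idPl; rewrite leqNgt; apply/negP => lj.
      by move: bk bj; rewrite /k (maxn_idPr (ltnW lj)) => ->; rewrite ltxx.
    rewrite -kl wE bk; have := b_half k; have := b_ge0 k.+2; rewrite bk; lra.
  right; rewrite /eta (negPf bk).
  have njk : (n j)%:R <= (M k)%:R :> R.
    by rewrite ler_nat; exact: leq_trans (n_le j) (M_mono _ _ jk).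
  have -> : (n j)%:R * (b k / (48 * (t 0%N + 1) * (M k)%:R)) * t 0%N =
      b k / 48 * ((n j)%:R / (M k)%:R * (t 0%N / (t 0%N + 1))).
    field; rewrite !gt_eqF//.
  apply: (@le_trans _ _ (b k / 48)); last by rewrite ler_pM2r// b_mono.
  rewrite ler_piMr ?divr_ge0// mulr_ile1 ?divr_ge0 ?(ltW t1)//.
    by rewrite ler_pdivrMr// mul1r.
  by rewrite ler_pdivrMr// mul1r lerDl.
have [x [f [x_le fx_diag fx_off]]] := exists_blocks n hX eta_gt0.
have /choice[y0 hy0] := fun j => ell1_sequence (n j) hY.
pose y j (i : 'I_(n j)) : Y := y0 j i.
have y_le1 j i : rnorm (y j i) <= 1 by have [h _] := hy0 j; exact: h.
have y_ge j (a : 'I_(n j) -> scalar_field R s) :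
    \sum_i ab (a i) <= 3 * rnorm (\sum_i a i *: y j i).
  have [_ h] := hy0 j.
  pose a' k := if insub k is Some i then a i else 0.
  have a'E (i : 'I_(n j)) : a' i = a i by rewrite /a' valK.
  have := h a'.
  under eq_bigr do rewrite a'E.
  by under [X in _ <= 3 * rnorm X -> _]eq_bigr do rewrite a'E.
pose U j := diag_op (y j) (t j - t j.+1) (f j).
have U_lin j : linear (U j) by exact: diag_op_linear.
have U_le j z : rnorm (U j z) <= (t j - t j.+1) * rnorm z by exact: diag_op_le.
have [T bT hT] := exists_series_op U_lin U_le t_ge0 t_cvg0.
exists T => // m A m1 _; split.
- have ex : exists j, (2 * m <= n j)%N.
    by exists (4 * m)%N; have := n_ge (4 * m)%N; have := M_ge (4 * m)%N; lia.
  case: (ex_minnP ex) => j hj jmin.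
  (* Block 0 has size 1, so [j] is positive, and by minimality the preceding block has size below
     [2 * m], so the preceding cut point is below [4 * m]. Either [M j] is twice that, below
     [8 * m], or [alpha] at the preceding cut point is at most [2 * b j]. *)
  have key : alpha (18 * m)%N <= 2 * b j.
    case: j hj jmin => [|j] hj jmin.
      by exfalso; move: hj; rewrite /n /= M0; lia.
    have hm : (n j < 2 * m)%N.
      by rewrite ltnNge; apply/negP => /jmin; rewrite ltnn.
    have nj := n_ge j.
    have [_ _ [Mj|Mj]] := hM j.
      have : alpha (18 * m)%N <= b j.+1.
        by apply: aM => //; rewrite Mj; lia.
      have := b_ge0 j.+1; lra.
    apply: le_trans Mj; apply: aM => //; lia.
  have bT' := bT.1.
  have := @gelfand_lower R s X Y n t b eta x f y n_gt0 w_ge0 t_ge0 t_cvg0 y_le1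
    y_ge x_le fx_diag fx_off eta_small b_le_w T j m bT' hj (fun N z => hT N z).
  apply: le_trans; rewrite lee_fin; have := b_ge0 j; lra.
- exact: gelfand_le_ideal_gelfand.
- exact: ideal_gelfand_le_ideal_approx.
- have ex : exists j, (m <= M j)%N by exists m; exact: ltnW.
  case: (ex_minnP ex) => j hj jmin.
  (* By minimality [m] exceeds the preceding cut point, so the sum of the first [j] blocks is an
     admissible approximant. *)
  have Pm : (P j < m)%N.
    case: j hj jmin => [//|j] hj jmin /=.
    by rewrite ltnNge; apply/negP => /jmin; rewrite ltnn.
  pose S z := \sum_(l < j) U l z.
  have hU l : (inorm A (U l) <= (t l - t l.+1)%:E)%E by exact: inorm_diag_op_le.
  have bS : bounded_op S.
    apply: (@inorm_bounded_op R s A).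
    by apply: le_lt_trans (inorm_sum_le (index_enum 'I_j) (fun l => hU l)) _; exact: ltry.
  have rS : rank_lt m S.
    exists (P j) => //; rewrite -n_sum; apply: rank_le_sum => l.
    exact: rank_le_diag_op.
  apply: le_trans (_ : inorm A (fun z => T z - S z)%R <= _)%E.
    by apply: ereal_inf_lbound; exists S.
  apply: le_trans (inorm_remainder_le t_ge0 t_cvg0 hT hU j) _.
  rewrite lee_fin; apply: le_trans (t_le j) _; rewrite ler_pM2l//.
  have /andP[c1 cm] := ceil_nat_bounds m1.
  apply: aM => //; exact: leq_trans hj.
Unshelve. all: by end_near.
Qed.
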